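(* Let $n\ge 1$ be an integer. Given an even tempered distribution $v_0$ on the real line, define radial tempered distributions $v_n$ on $\mathbf{R}^n$ and $v_{n+2}$ on $\mathbf{R}^{n+2}$ via the identities \[ \langle v_n,\varphi\rangle = \big\langle v_0, \tfrac12\,\omega_{n-1}\, r^{n-1}\varphi^o(r)\big\rangle \] for all radial Schwartz functions $\varphi(x)=\varphi^o(|x|)$ on $\mathbf{R}^n$, and \[ \langle v_{n+2},\varphi\rangle = \big\langle v_0, \tfrac12\,\omega_{n+1}\, r^{n+1}\varphi^o(r)\big\rangle \] for all radial Schwartz functions $\varphi(x)=\varphi^o(|x|)$ on $\mathbf{R}^{n+2}$. Let $u^n=F_n(v_n)$ and $u^{n+2}=F_{n+2}(v_{n+2})$. Then the identity \[ -\frac{1}{2\pi r}\frac{d}{dr}\, u^n_\diamond = u^{n+2}_\diamond \] holds in $\mathcal R_{n+2}'$.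
   Context: $\mathcal S(\mathbf{R}^m)$ and $\mathcal S'(\mathbf{R}^m)$ are the Schwartz space and the space of tempered distributions; $\omega_{m-1}$ is the surface area of the unit sphere $\mathbf{S}^{m-1}\subset\mathbf{R}^m$ (so $\omega_0=2$). A Schwartz function $\varphi$ on $\mathbf{R}^m$ is radial if $\varphi=\varphi\circ A$ for all $A\in O(m)$; a tempered distribution $u$ on $\mathbf{R}^m$ is radial if $\langle u,\varphi\rangle=\langle u,\varphi\circ A\rangle$ for all $A\in O(m)$ and $\varphi\in\mathcal S(\mathbf{R}^m)$ (for $m=1$, ''radial'' means ''even''). For $\varphi\in\mathcal S(\mathbf{R}^m)$, $\varphi^o$ is the even Schwartz function on $\mathbf{R}$ given by $\varphi^o(r)=\frac{1}{\omega_{m-1}}\int_{\mathbf{S}^{m-1}}\varphi(r\theta)\,d\theta$ (for $m=1$, $\varphi^o(x)=\frac12(\varphi(x)+\varphi(-x))$). For an even Schwartz function $\psi$ on $\mathbf{R}$, $\psi^O(x)=\psi(|x|)$ is the corresponding radial Schwartz function on $\mathbf{R}^m$. For general $\varphi\in\mathcal S(\mathbf{R}^m)$ put $\varphi^{rad}=(\varphi^o)^O$. A radial distribution $u$ satisfies $\langle u,\varphi\rangle=\langle u,\varphi^{rad}\rangle$, so it is determined by its values on radial Schwartz functions; this is how $v_n$ and $v_{n+2}$ are defined on all Schwartz functions. The Fourier transform on $\mathcal S(\mathbf{R}^m)$ is $F_m(\Phi)(\xi)=\int_{\mathbf{R}^m}\Phi(x)e^{-2\pi i x\cdot\xi}\,dx$,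 and on tempered distributions $\langle F_m(u),\varphi\rangle=\langle u,F_m(\varphi)\rangle$. The Fourier transform of a radial distribution is radial. For a positive integer $m$, $\mathcal R_m=r^{m-1}\mathcal S_{even}(\mathbf{R})$ is the space of functions on $\mathbf{R}$ of the form $\psi(r)r^{m-1}$ with $\psi$ an even Schwartz function on $\mathbf{R}$, with the topology inherited from $\mathcal S(\mathbf{R})$, and $\mathcal R_m'$ is its dual. For a radial tempered distribution $u$ on $\mathbf{R}^m$, $u_\diamond\in\mathcal R_m'$ is defined by \[ \langle u_\diamond,\psi(r)r^{m-1}\rangle=\frac{2}{\omega_{m-1}}\langle u,\psi^O\rangle\qquad(\psi\in\mathcal S_{even}(\mathbf{R})). \] The operator $\frac1r\frac{d}{dr}:\mathcal R_n'\to\mathcal R_{n+2}'$ is the dual of the map $-\frac{d}{dr}\frac1r:\mathcal R_{n+2}\to\mathcal R_n$, i.e. $\big\langle \frac1r\frac{d}{dr}w,\ r^{n+1}\psi(r)\big\rangle=-\big\langle w,\ (r^n\psi(r))'\big\rangle$ for $w\in\mathcal R_n'$ and $\psi\in\mathcal S_{even}(\mathbf{R})$. *)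

(* Defs.v *)
From HB Require Import structures.
From mathcomp Require Import all_boot all_order all_algebra.
From mathcomp Require Import all_classical all_reals all_analysis.
From mathcomp Require Import measurable_realfun complex.

Set Implicit Arguments.
Unset Strict Implicit.
Unset Printing Implicit Defensive.

Import Order.TTheory GRing.Theory Num.Theory.
Import numFieldNormedType.Exports.

Local Open Scope classical_set_scope.
Local Open Scope ring_scope.
Local Open Scope complex_scope.

(* Lebesgue measure on R^m lives on m.-tuples, which carry the product
   sigma-algebra; in dimension m.+1 it is the image of the product measure on
   R * R^m under (t, x) |-> t :: x. *)
Section lebesgue_measure_Rm.
Context {R : realType}.
Notation T := (measurableTypeR R).

Definition tuple_cons m (p : T * m.-tuple T) : m.+1.-tuple T :=
  [the m.+1.-tuple T of p.1 :: p.2].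

Lemma measurable_tuple_cons m :
  measurable_fun [set: T * m.-tuple T] (@tuple_cons m).
Proof. exact: measurable_cons. Qed.

HB.instance Definition _ m := isMeasurableFun.Build _ _ _ _ (@tuple_cons m)
  (@measurable_tuple_cons m).

Section step.
Variables (m : nat) (mu : {sigma_finite_measure set (m.-tuple T) -> \bar R}).

Definition lebesgue_step : set (m.+1.-tuple T) -> \bar R :=
  pushforward (lebesgue_measure \x mu)%E (@tuple_cons m).

Let step0 : lebesgue_step set0 = 0%E.
Proof. exact: measure0. Qed.

Let step_ge0 A : (0 <= lebesgue_step A)%E.
Proof. exact: measure_ge0. Qed.

Let step_sigma_additive : semi_sigma_additive lebesgue_step.
Proof. exact: measure_semi_sigma_additive. Qed.

HB.instance Definition _ := isMeasure.Build _ _ _ lebesgue_step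
  step0 step_ge0 step_sigma_additive.

Let step_sigma_finite : sigma_finite setT lebesgue_step.
Proof.
pose uncons (x : m.+1.-tuple T) : T * m.-tuple T :=
  (tnth x ord0, [tuple of behead x]).
have unconsK : cancel (@tuple_cons m) uncons.
  by move=> [t x]; congr pair => //; exact: val_inj.
have muncons : measurable_fun [set: m.+1.-tuple T] uncons.
  apply: measurable_fun_pair; first exact: measurable_tnth.
  exact: measurable_behead.
have /sigma_finiteP[F [TF ndF Foo]] :=
  sigma_finiteT (lebesgue_measure : {sigma_finite_measure set T -> \bar R}).
have /sigma_finiteP[G [TG ndG Goo]] := sigma_finiteT mu.
exists (fun n => uncons @^-1` (F n `*` G n)).
  rewrite -preimage_bigcup (_ : \bigcup_n _ = setT) ?preimage_setT//.
  apply/seteqP; split => // -[t x] _.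
  have [i _ Fi] : (\bigcup_n F n) t by rewrite -TF.
  have [j _ Gj] : (\bigcup_n G n) x by rewrite -TG.
  exists (maxn i j) => //; split => /=.
  - by move: t Fi; exact/subsetPset/ndF/leq_maxl.
  - by move: x Gj; exact/subsetPset/ndG/leq_maxr.
move=> n; have [mF Fn] := Foo n; have [mG Gn] := Goo n; split.
  by rewrite -[X in measurable X]setTI; apply: muncons => //; exact: measurableX.
rewrite /lebesgue_step /pushforward -comp_preimage.
suff -> : uncons \o @tuple_cons m = id.
  by rewrite preimage_id product_measure1E// lte_mul_pinfty// ge0_fin_numE.
by apply/funext => p /=; rewrite unconsK.
Qed.

HB.instance Definition _ := Measure_isSigmaFinite.Build _ _ _ lebesgue_step
  step_sigma_finite.

End step.

Fixpoint lebesgue_tuple m : {sigma_finite_measure set (m.-tuple T) -> \bar R} :=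
  if m is m'.+1 then lebesgue_step (lebesgue_tuple m') else \d_([tuple]).

Definition row_of_tuple m (x : m.-tuple T) : 'rV[R]_m := \row_i tnth x i.

Definition dot m (x y : 'rV[R]_m) : R := \sum_i x 0 i * y 0 i.

(* Euclidean norm; `|x| is the sup norm on 'rV. *)
Definition enorm m (x : 'rV[R]_m) : R := Num.sqrt (dot x x).

Definition direction m (x : m.-tuple T) : m.-tuple T :=
  [tuple tnth x i / enorm (row_of_tuple x) | i < m].

Definition punctured_ball m : set (m.-tuple T) :=
  [set x | 0 < enorm (row_of_tuple x) <= 1].

Lemma measurable_enorm m :
  measurable_fun [set: m.-tuple T] (fun x => enorm (row_of_tuple x) : T).
Proof.
have msqrt : measurable_fun [set: T] (@Num.sqrt R : T -> T).
  apply: continuous_measurable_fun => x; exact: sqrt_continuous.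
apply: (measurableT_comp msqrt).
apply: measurable_sum => i; apply: measurable_funM.
- by under eq_fun do rewrite mxE; exact: measurable_tnth.
- by under eq_fun do rewrite mxE; exact: measurable_tnth.
Qed.

Lemma measurable_punctured_ball m : measurable (@punctured_ball m).
Proof.
rewrite (_ : @punctured_ball m =
  (fun x => enorm (row_of_tuple x) : T) @^-1` `]0, 1]%classic).
  by rewrite -[X in measurable X]setTI; exact: measurable_enorm.
by apply/seteqP; split => x /=; rewrite in_itv.
Qed.

Lemma measurable_direction m : measurable_fun [set: m.-tuple T] (@direction m).
Proof.
apply/measurable_fun_tnthP => i.
rewrite (_ : _ \o _ =
    (fun x : m.-tuple T => tnth x i * (enorm (row_of_tuple x))^-1)); last first.
  by apply/funext => x /=; rewrite tnth_mktuple.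
apply: measurable_funM; first exact: measurable_tnth.
suff minv : measurable_fun [set: T] (@GRing.inv R : T -> T).
  exact: (measurableT_comp minv (@measurable_enorm m)).
have -> : [set: T] = [set (0 : R)] `|` ~` [set 0].
  by rewrite setUCr.
have o0 : open (~` [set (0 : R)]).
  exact/closed_openC/accessible_closed_set1/hausdorff_accessible/Rhausdorff.
apply/measurable_funU => //.
- exact: open_measurable.
- split; first exact: measurable_fun_set1.
  apply: open_continuous_measurable_fun => // x.
  by rewrite inE => /= /eqP x0; exact: inv_continuous.
Qed.

HB.instance Definition _ m := isMeasurableFun.Build _ _ _ _ (@direction m)
  (@measurable_direction m).

Section sphere_measure.
Variable m : nat.

Definition cone_measure : set (m.-tuple T) -> \bar R :=
  pushforward (mrestr (lebesgue_tuple m) (@measurable_punctured_ball m))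
    (@direction m).

Let cone0 : cone_measure set0 = 0%E.
Proof. exact: measure0. Qed.

Let cone_ge0 A : (0 <= cone_measure A)%E.
Proof. exact: measure_ge0. Qed.

Let cone_sigma_additive : semi_sigma_additive cone_measure.
Proof. exact: measure_semi_sigma_additive. Qed.

HB.instance Definition _ := isMeasure.Build _ _ _ cone_measure
  cone0 cone_ge0 cone_sigma_additive.

(* Surface measure of the unit sphere of R^m: a subset A of the sphere has
   measure m times the volume of the cone {t theta | 0 < t <= 1, theta in A}.
   For m = 1 this is the counting measure on {-1, 1}. *)
Definition sphere_measure : {measure set (m.-tuple T) -> \bar R} :=
  mscale (m%:R%:nng : {nonneg R}) cone_measure.

(* The constant omega_(m-1) of the unit sphere S^(m-1) of R^m. *)
Definition sphere_area : R := fine (sphere_measure setT).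

End sphere_measure.

End lebesgue_measure_Rm.

Section complex_valued.
Context {R : realType}.

Definition cintegral d (T : measurableType d) (mu : {measure set T -> \bar R})
    (f : T -> R[i]) : R[i] :=
  (\int[mu]_x complex.Re (f x)) +i* (\int[mu]_x complex.Im (f x)).

Definition cis (t : R) : R[i] := cos t +i* sin t.

Variable V : normedModType R.
Implicit Types (f g : V -> R[i]) (x v : V) (vs : seq V).

Definition cderive v f x : R[i] :=
  'D_v (fun y => complex.Re (f y)) x +i* 'D_v (fun y => complex.Im (f y)) x.

Definition cderives vs f : V -> R[i] := foldr cderive f vs.

Definition smooth f := forall vs,
  [/\ continuous (fun x => complex.Re (cderives vs f x)),
      continuous (fun x => complex.Im (cderives vs f x)) &
      forall v x, derivable (fun y => complex.Re (cderives vs f y)) x v /\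
                  derivable (fun y => complex.Im (cderives vs f y)) x v].

(* sup_x |x|^k |D_(v_1) ... D_(v_j) f (x)|, for (k, [:: v_1; ...; v_j]). When V
   has finite dimension, these generate the same topology as the seminorms
   that only use the partial derivatives along a basis. *)
Definition seminorm (p : nat * seq V) f : \bar R :=
  ereal_sup
    [set (`|x| ^+ p.1 * ComplexField.Normc.normc (cderives p.2 f x))%:E
    | x in setT].

Definition schwartz : set (V -> R[i]) :=
  [set f | smooth f /\ forall p, (seminorm p f < +oo)%E].

(* Functionals are total on V -> R[i]; only their values on E matter. The
   second clause is continuity at 0 for the topology that E inherits from the
   Schwartz space. *)
Definition dual (E : set (V -> R[i])) : set ((V -> R[i]) -> R[i]) :=
  [set u |
    (forall a f g, E f -> E g -> u (fun x => a * f x + g x) = a * u f + u g) /\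
    (forall e : R, 0 < e -> exists (ps : seq (nat * seq V)) (d : R), 0 < d /\
       forall f, E f -> (forall p, p \in ps -> (seminorm p f < d%:E)%E) ->
         ComplexField.Normc.normc (u f) < e)].

End complex_valued.

Definition tempered {R : realType} (V : normedModType R) :
  set ((V -> R[i]) -> R[i]) := dual (@schwartz R V).
Arguments tempered {R} V.
Arguments schwartz {R} V.

Section even.
Context {R : realType}.

Definition even_fun (f : R -> R[i]) := forall r, f (- r) = f r.

Definition even_distr (u : (R -> R[i]) -> R[i]) :=
  forall f, schwartz R f -> u f = u (fun r => f (- r)).

End even.

Section radial.
Context {R : realType} (m : nat).
Local Notation Rm := 'rV[R]_m.
Implicit Types (f : Rm -> R[i]) (u : (Rm -> R[i]) -> R[i]).

Definition orthogonal_mx (A : 'M[R]_m) := A *m A^T = 1%:M.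

Definition radial_fun f :=
  forall A, orthogonal_mx A -> forall x, f (x *m A) = f x.

Definition radial_distr u := forall A f, orthogonal_mx A -> schwartz Rm f ->
  u f = u (fun x => f (x *m A)).

(* phi^o *)
Definition spherical_mean f (r : R) : R[i] :=
  ((sphere_area m)^-1)%:C *
  cintegral (sphere_measure m) (fun theta => f (r *: row_of_tuple theta)).

(* psi^O *)
Definition radial_ext (psi : R -> R[i]) (x : Rm) : R[i] := psi (enorm x).

Definition fourier f (xi : Rm) : R[i] :=
  cintegral (lebesgue_tuple m) (fun x =>
    f (row_of_tuple x) * cis (- (2 * pi * dot (row_of_tuple x) xi))).

Definition fourier_distr u : (Rm -> R[i]) -> R[i] := fun f => u (fourier f).

End radial.
Arguments radial_ext {R} m.

Section diamond.
Context {R : realType} (m : nat).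
Implicit Types psi f : R -> R[i].

Definition even_schwartz : set (R -> R[i]) :=
  [set psi | schwartz R psi /\ even_fun psi].

Definition weighted psi (r : R) : R[i] := psi r * (r ^+ m.-1)%:C.

Definition Rspace : set (R -> R[i]) := weighted @` even_schwartz.

(* The psi such that f = psi(r) r^(m-1); it is unique, see weighted_inj. *)
Definition unweight f : R -> R[i] :=
  xget (fun=> 0) [set psi | even_schwartz psi /\ weighted psi = f].

Definition diamond (u : ('rV[R]_m -> R[i]) -> R[i]) : (R -> R[i]) -> R[i] :=
  fun f => (2 / sphere_area m)%:C * u (radial_ext m (unweight f)).

Lemma weighted_inj : {in even_schwartz &, injective weighted}.
Proof.
move=> p q /[!inE] -[[sp _] _] [[sq _] _] pq.
have E r : r != 0 -> p r = q r.
  move=> r0; have := congr1 (fun h => h r) pq; rewrite /weighted.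
  apply: mulIf; rewrite -[0](rmorph0 (real_complex R)).
  by rewrite (inj_eq (fmorph_inj _)) expf_neq0.
have ext (F G : R -> R) : continuous F -> continuous G ->
    (forall r, r != 0 -> F r = G r) -> F 0 = G 0.
  move=> cF cG FG; apply: (@cvg_unique _ (@Rhausdorff R) (F x @[x --> 0^'+])).
    exact/cvg_at_right_filter/cF.
  apply: cvg_trans (cvg_at_right_filter (cG 0)); apply: near_eq_cvg.
  by near=> x; rewrite FG// gt_eqF.
have [cp1 cp2 _] := sp [::]; have [cq1 cq2 _] := sq [::].
apply/funext => r; have [->|/E//] := eqVneq r 0.
have e1 := ext _ _ cp1 cq1 (fun s s0 => congr1 (@complex.Re R) (E s s0)).
have e2 := ext _ _ cp2 cq2 (fun s s0 => congr1 (@complex.Im R) (E s s0)).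
by move: e1 e2 => /=; case: (p 0) (q 0) => [? ?] [? ?] /= -> ->.
Unshelve. all: by end_near. Qed.

Lemma diamondE u psi : even_schwartz psi ->
  diamond u (weighted psi) = (2 / sphere_area m)%:C * u (radial_ext m psi).
Proof.
move=> epsi; rewrite /diamond; congr (_ * u (radial_ext _ _)).
rewrite /unweight; case: xgetP => [p _ [ep /weighted_inj]|/(_ psi)].
  by apply; rewrite inE.
by case.
Qed.

End diamond.

(* The dual of f |-> - (f / r)'. For f = r^(n+1) psi with n > 0, the convention
   x / 0 = 0 gives f / r = r^n psi also at r = 0. *)
Definition inv_r_ddr {R : realType} (w : (R -> R[i]) -> R[i]) :
    (R -> R[i]) -> R[i] :=
  fun f => - w (fun r => cderive (1 : R) (fun s => f s / s%:C) r).

(* Main.v *)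
(* Both sides only involve Fourier transforms of radial Schwartz functions, which
   depend on |xi| alone, so the theorem reduces to the pointwise identity
     F_n((n psi + r psi')^O)(eta) = 2 pi |eta|^2 F_(n+2)(psi^O)(0, 0, eta).
   Put chi = psi'/r, again an even Schwartz function. In R^(n+2) we have
   d_j (psi^O) = x_j chi^O, and integrating chi^O over the two extra variables
   gives - 2 pi psi^O on R^n (polar coordinates in the plane). Taking Fourier
   transforms, i eta_j F_(n+2)(psi^O)(0, 0, eta) = - F_n(x_j psi^O)(eta), and
   sum_j d_j (x_j psi^O) = (n psi + r psi')^O on R^n.

   The Fourier transform g^ of a radial g is radial because, for w orthogonal to
   eta, the derivative of g^ at eta in the direction w vanishes: up to a constant
   it is the transform of (x.w) g, and two integrations by parts apply to the identity
   (eta.d)((x.w) g) = (w.d)((x.eta) g). *)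

Require Import Defs.
From mathcomp Require Import all_boot all_order all_algebra.
From mathcomp Require Import all_classical all_reals all_analysis.
From mathcomp Require Import measurable_realfun complex ring lra.

Set Implicit Arguments.
Unset Strict Implicit.
Unset Printing Implicit Defensive.

Import Order.TTheory GRing.Theory Num.Theory.
Import numFieldNormedType.Exports.

Local Open Scope classical_set_scope.
Local Open Scope ring_scope.

(** * Real Schwartz functions *)

(** The analysis is carried out on real functions: a Schwartz function is handled through its real
    and imaginary parts, and since radial functions are even, their Fourier transform reduces to
    cosine transforms. The identities for [vn] and [vn2] apply to radial Schwartz functions only,
    and [v0] is linear only on Schwartz functions, so the transform of psi^O has to be shown both
    Schwartz and radial; much of the development serves this.

    Lebesgue measure on tuples is an iterated product. Translations and reflections preserve it
    coordinate by coordinate, which is what integration by parts and parity rest on. Rotations mix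
    the coordinates, which is why radiality comes from a differential identity instead of a change
    of variables. Integrability on tuples is deduced from bounds by a multiple of prod_i 1 / (1 +
    x_i^2), which splits along the product.

    The spherical mean of a radial function is one of its values as soon as the surface measure
    lives on unit vectors and has finite positive mass. *)

Section rschwartz.
Context {R : realType} {V : normedModType R}.
Implicit Types (g h l : V -> R) (v x : V) (vs : seq V).

Definition derives vs g : V -> R := foldr (fun v h => 'D_v h) g vs.

Definition rapid g := forall k, exists M, forall x, `|x| ^+ k * `|g x| <= M.

(** Real counterpart of [schwartz], with explicit bounds in place of finite extended-real suprema;
    [schwartzP] is the bridge. *)
Definition rschwartz : set (V -> R) :=
  [set g | forall vs, [/\ continuous (derives vs g),
    forall x v, derivable (derives vs g) x v & rapid (derives vs g)]].

Lemma Re_cderives vs (f : V -> R[i]) :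
  (fun x => complex.Re (cderives vs f x)) = derives vs (fun x => complex.Re (f x)).
Proof. by elim: vs => //= v vs <-. Qed.

Lemma Im_cderives vs (f : V -> R[i]) :
  (fun x => complex.Im (cderives vs f x)) = derives vs (fun x => complex.Im (f x)).
Proof. by elim: vs => //= v vs <-. Qed.

Lemma ler_Re_normc (z : R[i]) : `|complex.Re z| <= ComplexField.Normc.normc z.
Proof.
case: z => a b /=; rewrite -sqrtr_sqr ler_wsqrtr//.
by rewrite lerDl sqr_ge0.
Qed.

Lemma ler_Im_normc (z : R[i]) : `|complex.Im z| <= ComplexField.Normc.normc z.
Proof.
case: z => a b /=; rewrite -sqrtr_sqr ler_wsqrtr//.
by rewrite lerDr sqr_ge0.
Qed.

Lemma normc_leD (z : R[i]) :
  ComplexField.Normc.normc z <= `|complex.Re z| + `|complex.Im z|.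
Proof.
case: z => a b /=; rewrite -[leRHS]ger0_norm ?addr_ge0// -sqrtr_sqr ler_wsqrtr//.
rewrite sqrrD !real_normK ?num_real// addrAC lerDl mulrn_wge0//.
Qed.

Lemma schwartzP (f : V -> R[i]) : schwartz V f <->
  rschwartz (fun x => complex.Re (f x)) /\ rschwartz (fun x => complex.Im (f x)).
Proof.
have E1 vs x : complex.Re (cderives vs f x) = derives vs (fun x => complex.Re (f x)) x.
  by rewrite -Re_cderives.
have E2 vs x : complex.Im (cderives vs f x) = derives vs (fun x => complex.Im (f x)) x.
  by rewrite -Im_cderives.
split=> [[sf df]|[rf imf]].
  have dec k vs : exists M, forall x,
      `|x| ^+ k * ComplexField.Normc.normc (cderives vs f x) <= M.
    have := df (k, vs); rewrite /seminorm/=; set s := ereal_sup _ => soo.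
    exists (fine s) => x; rewrite -lee_fin fineK.
      by apply: ereal_sup_ubound; exists x.
    rewrite ge0_fin_numE//; apply: le_trans (ereal_sup_ubound _); last by exists x.
    by rewrite lee_fin mulr_ge0 ?exprn_ge0//; case: (cderives _ _ _) => a b; exact: sqrtr_ge0.
  split=> vs; have [c1 c2 dd] := sf vs; rewrite -?Re_cderives -?Im_cderives; split => //.
  - by move=> x v; exact: (dd v x).1.
  - move=> k; have [M HM] := dec k vs; exists M => x; apply: le_trans (HM x).
    by rewrite ler_wpM2l ?exprn_ge0// ler_Re_normc.
  - by move=> x v; exact: (dd v x).2.
  - move=> k; have [M HM] := dec k vs; exists M => x; apply: le_trans (HM x).
    by rewrite ler_wpM2l ?exprn_ge0// ler_Im_normc.
split.
  move=> vs; have [c1 d1 _] := rf vs; have [c2 d2 _] := imf vs.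
  by rewrite Re_cderives Im_cderives; split.
move=> [k vs]; rewrite /seminorm/=.
have [_ _ /(_ k)[M1 H1]] := rf vs; have [_ _ /(_ k)[M2 H2]] := imf vs.
apply: (@le_lt_trans _ _ (M1 + M2)%:E); last exact: ltry.
apply: ge_ereal_sup => _ [x _ <-]; rewrite lee_fin.
apply: le_trans (lerD (H1 x) (H2 x)); rewrite -mulrDr ler_wpM2l ?exprn_ge0//.
by rewrite -E1 -E2 normc_leD.
Qed.

(** Coinductive principle behind the membership proofs: a class closed under directional derivatives
    contains all iterated derivatives of its members, so regularity and decay need to be checked on
    the class only once. *)
Lemma rschwartz_sub (P : set (V -> R)) :
  (forall g, P g -> [/\ continuous g, forall x v, derivable g x v,
    forall v, P ('D_v g) & rapid g]) -> P `<=` rschwartz.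
Proof.
move=> HP g Pg vs; have Pvs : P (derives vs g).
  by elim: vs => //= v vs /HP[].
by have [] := HP _ Pvs.
Qed.

Lemma rschwartzD1 g v : rschwartz g -> rschwartz ('D_v g).
Proof.
move=> sg vs; have -> : derives vs ('D_v g) = derives (rcons vs v) g.
  by rewrite /derives foldr_rcons.
exact: sg.
Qed.

Lemma rschwartzW g : rschwartz g ->
  [/\ continuous g, forall x v, derivable g x v & rapid g].
Proof. by move/(_ [::]). Qed.

Definition linform l := continuous l /\
  (forall a x y, l (a *: x + y) = a * l x + l y) /\
  exists2 C : R, 0 <= C & forall x, `|l x| <= C * `|x|.

Lemma is_derive_linform l x v : linform l -> is_derive x v l (l v).
Proof.
move=> [cl [ll _]].
have E : (fun h : R => h^-1 *: (l (h *: v + x) - l x)) @ 0^' --> l v.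
  apply: cvg_near_cst; near=> h; rewrite ll addrK /GRing.scale/= mulKf//.
  by near: h; exact: nbhs_dnbhs_neq.
apply: DeriveDef; first by apply/cvg_ex; exists (l v); exact: E.
exact/cvg_lim.
Unshelve. all: by end_near. Qed.

(* The module generated by B over the algebra of polynomial functions. *)
Inductive polymod (B : set (V -> R)) : set (V -> R) :=
| polymod_base g : B g -> polymod B g
| polymodD g h : polymod B g -> polymod B h -> polymod B (fun x => g x + h x)
| polymodZ a g : polymod B g -> polymod B (fun x => a * g x)
| polymodM l g : linform l -> polymod B g -> polymod B (fun x => l x * g x).

Lemma rapidD g h : rapid g -> rapid h -> rapid (fun x => g x + h x).
Proof.
move=> rg rh k; have [M HM] := rg k; have [N HN] := rh k.
exists (M + N) => x; apply: le_trans (lerD (HM x) (HN x)).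
by rewrite -mulrDr ler_wpM2l ?exprn_ge0// ler_normD.
Qed.

Lemma rapidZ a g : rapid g -> rapid (fun x => a * g x).
Proof.
move=> rg k; have [M HM] := rg k; exists (`|a| * M) => x.
by rewrite normrM mulrCA ler_wpM2l.
Qed.

Lemma rapidM l g : linform l -> rapid g -> rapid (fun x => l x * g x).
Proof.
move=> [_ [_ [C C0 lC]]] rg k; have [M HM] := rg k.+1; exists (C * M) => x.
apply: le_trans (ler_wpM2l C0 (HM x)).
rewrite normrM exprSr -!mulrA [leRHS]mulrCA ler_wpM2l ?exprn_ge0// mulrA.
by rewrite ler_wpM2r.
Qed.

(** By the Leibniz rule the module is closed under derivatives as soon as the derivatives of its
    generators fall back into it; they may pick up polynomial factors. *)
Lemma polymod_rschwartz (B : set (V -> R)) :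
  (forall g, B g -> [/\ continuous g, forall x v, derivable g x v,
    forall v, polymod B ('D_v g) & rapid g]) -> polymod B `<=` rschwartz.
Proof.
move=> HB; apply: rschwartz_sub => g; elim=> {g}.
- exact: HB.
- move=> g h _ [cg dg Dg rg] _ [ch dh Dh rh]; split.
  + by move=> x; apply: cvgD; [exact: cg|exact: ch].
  + by move=> x v; apply: derivableD.
  + move=> v; have -> : 'D_v (fun x => g x + h x) = fun x => 'D_v g x + 'D_v h x.
      by apply/funext => x; rewrite -deriveD.
    exact: polymodD.
  + exact: rapidD.
- move=> a g _ [cg dg Dg rg]; split.
  + by move=> x; apply: cvgM; [exact: cvg_cst|exact: cg].
  + by move=> x v; apply: derivableM => //; exact: derivable_cst.
  + move=> v; have -> : 'D_v (fun x => a * g x) = fun x => a * 'D_v g x.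
      by apply/funext => x; rewrite -[RHS]/(a *: 'D_v g x) -deriveZ.
    exact: polymodZ.
  + exact: rapidZ.
- move=> l g Ll Pg [cg dg Dg rg]; have [cl [ll lC]] := Ll; split.
  + by move=> x; apply: cvgM; [exact: cl|exact: cg].
  + move=> x v; apply: derivableM => //.
    by have [] := is_derive_linform x v Ll.
  + move=> v; have -> : 'D_v (fun x => l x * g x) =
        fun x => l x * 'D_v g x + l v * g x.
      apply/funext => x; have [dl lE] := is_derive_linform x v Ll.
      by rewrite [l v * _]mulrC -lE; exact: deriveM dl (dg x v).
    by apply: polymodD; [exact: polymodM|exact: polymodZ].
  + exact: rapidM.
Qed.

Lemma rschwartz_polymod : polymod rschwartz `<=` rschwartz.
Proof.
apply: polymod_rschwartz => g sg; have [cg dg rg] := rschwartzW sg; split => //.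
by move=> v; exact/polymod_base/rschwartzD1.
Qed.

Lemma rschwartzD g h : rschwartz g -> rschwartz h -> rschwartz (fun x => g x + h x).
Proof.
by move=> ? ?; apply/rschwartz_polymod/polymodD; exact: polymod_base.
Qed.

Lemma rschwartzZ a g : rschwartz g -> rschwartz (fun x => a * g x).
Proof. by move=> ?; exact/rschwartz_polymod/polymodZ/polymod_base. Qed.

Lemma rschwartzM l g : linform l -> rschwartz g -> rschwartz (fun x => l x * g x).
Proof. by move=> ? ?; apply/rschwartz_polymod/polymodM => //; exact: polymod_base. Qed.

Lemma rschwartz0 : rschwartz (fun=> 0).
Proof.
apply: (@rschwartz_sub [set (fun=> 0)]) => // _ ->; split.
- by move=> x; exact: cvg_cst.
- by move=> x v; exact: derivable_cst.
- by move=> v; apply/funext => x; rewrite derive_cst.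
- by move=> k; exists 0 => x; rewrite normr0 mulr0.
Qed.

Lemma rschwartz_sum (I : Type) (s : seq I) (F : I -> V -> R) :
  (forall i, rschwartz (F i)) -> rschwartz (fun x => \sum_(i <- s) F i x).
Proof.
move=> sF; elim: s => [|i s IH].
  by under eq_fun do rewrite big_nil; exact: rschwartz0.
by under eq_fun do rewrite big_cons; exact: rschwartzD.
Qed.

End rschwartz.
Arguments rschwartz {R} V.

(** * Restriction of Schwartz functions to a line through the origin *)

Section rschwartz_restrict.
Context {R : realType} {V : normedModType R}.

Lemma derive_line (g : V -> R) (e : V) (r s : R) :
  (forall x v, derivable g x v) ->
  is_derive r s (fun t : R => g (t *: e)) ('D_(s *: e) g (r *: e)).
Proof.
move=> dg; have E : (fun h : R => h^-1 *: (g ((h *: s + r) *: e) - g (r *: e)))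
    @ 0^' --> 'D_(s *: e) g (r *: e).
  have := dg (r *: e) (s *: e); rewrite /derivable/derive => /cvg_ex[l lc].
  have := lc => /cvg_lim -> //.
  by under eq_fun do rewrite scalerDl -scalerA.
by apply: DeriveDef; [apply/cvg_ex; eexists; exact: E|exact/cvg_lim].
Qed.

(** Differentiating h(t e) in direction v gives the restriction of ['D_(v *: e) h], so restrictions
    to the line form a closed class; |e| = 1 transfers the decay. This makes r |-> F(r e) an
    admissible argument of [v0]. *)
Lemma rschwartz_line (g : V -> R) (e : V) : `|e| = 1 ->
  rschwartz V g -> rschwartz R (fun t : R => g (t *: e)).
Proof.
move=> e1 sg; apply: (@rschwartz_sub _ _
  [set f | exists2 h, rschwartz V h & f = fun t : R => h (t *: e)]); last by exists g.
move=> _ [h sh ->]; have [ch dh rh] := rschwartzW sh; split.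
- move=> t; apply: (@continuous_comp _ _ _ (fun t : R => t *: e) h).
    exact: scalel_continuous.
  exact: ch.
- by move=> x v; have [] := derive_line e x v dh.
- move=> v; exists ('D_(v *: e) h); first exact: rschwartzD1.
  by apply/funext => t; have [_ ->] := derive_line e t v dh.
- move=> k; have [M HM] := rh k; exists M => t; apply: le_trans (HM (t *: e)).
  by rewrite normrZ e1 mulr1.
Qed.

End rschwartz_restrict.

(** * Division of odd Schwartz functions by the variable *)

Lemma continuousT_comp (S T U : topologicalType) (f : S -> T) (g : T -> U) :
  continuous f -> continuous g -> continuous (g \o f).
Proof. by move=> cf cg x; apply: continuous_comp; [exact: cf|exact: cg]. Qed.

Lemma continuousTD (R : realType) (T : topologicalType) (f g : T -> R) :
  continuous f -> continuous g -> continuous (fun x => f x + g x).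
Proof. by move=> cf cg x; apply: cvgD; [exact: cf|exact: cg]. Qed.

Lemma continuousTM (R : realType) (T : topologicalType) (f g : T -> R) :
  continuous f -> continuous g -> continuous (fun x => f x * g x).
Proof. by move=> cf cg x; apply: cvgM; [exact: cf|exact: cg]. Qed.

Lemma is_derive_mul (R : realType) (c x : R) : is_derive x 1 (fun t : R => c * t) c.
Proof.
have := @is_deriveZ R _ _ id c x 1 1 (is_derive_id _ _).
by rewrite [_ *: _]mulr1.
Qed.

Lemma is_derive_mulC (R : realType) (c x : R) : is_derive x 1 (fun t : R => t * c) c.
Proof. by under eq_fun do rewrite mulrC; exact: is_derive_mul. Qed.

Section hadamard.
Context {R : realType}.
Notation mu := (@lebesgue_measure R).

Lemma is_derive1_dir (f : R -> R) (x v d : R) :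
  is_derive x 1 f d -> is_derive x v f (v * d).
Proof.
move=> [/derivable1_diffP df fE].
apply: DeriveDef; first exact: diff_derivable.
by rewrite deriveE// -[v in LHS]mulr1 -/(v *: 1) linearZ/= -deriveE// fE.
Qed.

Variable g : R -> R.
Hypothesis sg : rschwartz R g.
Hypothesis g0 : g 0 = 0.

Let dn k : R -> R := @derives R R (nseq k (1 : R)) g.

Let dnS k (x : R) : is_derive x 1 (dn k) (dn k.+1 x).
Proof. by have [_ /(_ x 1) d _] := sg (nseq k (1 : R)); apply: DeriveDef. Qed.

Let dn_cont k : continuous (dn k).
Proof. by have [] := sg (nseq k (1 : R)). Qed.

Let dn_rapid k : rapid (dn k).
Proof. by have [] := sg (nseq k (1 : R)). Qed.

Let f k (r t : R) := t ^+ k * dn k.+1 (t * r).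
Let H k r := \int[mu]_(t in `[0, 1]) f k r t.

Let df k (r t : R) : is_derive r 1 ((f k) ^~ t) (f k.+1 r t).
Proof.
have d1 := is_derive_mul t r.
have d2 : is_derive r 1 (fun s => dn k.+1 (t * s)) (t * dn k.+2 (t * r)).
  by rewrite mulrC; exact: (@is_derive1_comp _ (dn k.+1) _ _ _ _ (dnS _ _) d1).
have := @is_deriveZ R _ _ _ (t ^+ k) r 1 _ d2.
by rewrite /f exprSr -mulrA.
Qed.

Let f_cont k r : continuous (f k r).
Proof.
have c2 : continuous (fun t : R => dn k.+1 (t * r)).
  exact: (continuousT_comp (@mulrr_continuous _ r) (@dn_cont k.+1)).
by move=> t; apply: cvgM; [exact: exprn_continuous|exact: c2].
Qed.

Let f_int k r : mu.-integrable `[0, 1] (EFin \o f k r).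
Proof.
apply: continuous_compact_integrable; first exact: segment_compact.
exact/continuous_subspaceT/f_cont.
Qed.

Let dn_bound k : exists2 M : R, 0 <= M & forall x, `|dn k x| <= M.
Proof.
have [M HM] := dn_rapid k 0; exists M => [|x].
  by apply: le_trans (HM 0); rewrite mulr_ge0.
by have := HM x; rewrite expr0 mul1r.
Qed.

Let f_bound k : exists2 M : R, 0 <= M & forall r t : R, 0 <= t <= 1 -> `|f k r t| <= M.
Proof.
have [M M0 HM] := dn_bound k.+1; exists M => // r t /andP[t0 t1].
rewrite normrM -[leRHS]mul1r ler_pM// normrX exprn_ile1//.
by rewrite ger0_norm.
Qed.

(* [H k] is the [k]-th derivative of [r |-> int_0^1 g'(t r) dt = g(r) / r]. *)
Let dH k (r : R) : is_derive r 1 (H k) (H k.+1 r).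
Proof.
have [M M0 HM] := f_bound k.+1.
have ri : `]r - 1, r + 1[%classic r.
  by rewrite /= in_itv/= ltrDl ltr01 andbT gtrBl ltr01.
have iM : mu.-integrable `[0, 1] (EFin \o cst M).
  apply: continuous_compact_integrable; first exact: segment_compact.
  by apply/continuous_subspaceT => x; exact: cvg_cst.
have dd x y : derivable ((f k) ^~ y) x 1 by have [] := df k x y.
have d1E : partial1of2 (f k) = f k.+1.
  apply/funext => s; apply/funext => y; rewrite partial1of2E.
  by have [] := df k s y.
have Gub x y : `]r - 1, r + 1[%classic x -> `[0, 1]%classic y ->
    `|partial1of2 (f k) x y| <= cst M y.
  by rewrite d1E => _ /= ; rewrite in_itv/= => /HM.
have mI : measurable (`[0, 1]%classic : set (measurableTypeR R)) by [].
have fi x : `]r - 1, r + 1[%classic x -> mu.-integrable `[0, 1] (EFin \o f k x).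
  by move=> _; exact: f_int.
apply: DeriveDef.
  exact: (derivable_under_integral mI ri fi (fun x y _ _ => dd x y) (fun _ => M0) iM Gub).
rewrite -derive1E.
have -> := differentiation_under_integral mI ri fi (fun x y _ _ => dd x y) (fun _ => M0) iM Gub.
by rewrite /H -d1E.
Qed.

Let H0 r : r * H 0 r = g r.
Proof.
rewrite /H -RintegralZl//.
rewrite /Rintegral (@continuous_FTC2 _ _ (fun t => g (t * r)) 0 1)//=.
- by rewrite mul1r mul0r g0 subr0.
- apply: continuous_subspaceT => t.
  by apply: cvgM; [exact: cvg_cst|exact: f_cont].
- have cg : continuous (fun t : R => g (t * r)).
    have [cg _ _] := rschwartzW sg.
    exact: (continuousT_comp (@mulrr_continuous _ r) cg).
  split; [|exact: cvg_at_right_filter (cg 0)|exact: cvg_at_left_filter (cg 1)].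
  by move=> t _; have [] := is_derive1_comp (dnS 0 _) (is_derive_mulC r t).
- move=> t _; rewrite derive1E.
  have [_ ->] := is_derive1_comp (dnS 0 _) (is_derive_mulC r t).
  by rewrite /f expr0 mul1r mulrC.
Qed.

(** The (k+1)-st derivative of [r * H 0 r = g r] by the Leibniz rule, in which only the first
    derivative of the factor r survives. *)
Let HS k r : r * H k.+1 r = dn k.+1 r - k.+1%:R * H k r.
Proof.
have dr (x : R) : is_derive x 1 (id : R -> R) 1 by exact: is_derive_id.
have dM j : is_derive r 1 (fun r => r * H j r) (r * H j.+1 r + H j r * 1).
  exact: is_deriveM.
elim: k r dM => [|k IH] r dM.
  have E : (fun r => r * H 0 r) = dn 0 by apply/funext => x; rewrite H0.
  have [_ e1] := dnS 0 r; have := dM 0%N; rewrite E => -[_]; rewrite e1 => ->.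
  by move: (_ * H 1 r) (H 0 r) => a b; ring.
have E : (fun r => r * H k.+1 r) = (fun r => dn k.+1 r - k.+1%:R * H k r).
  apply/funext => x; apply: IH => j; exact: is_deriveM.
have d2 : is_derive r 1 (fun r => dn k.+1 r - k.+1%:R * H k r)
    (dn k.+2 r - k.+1%:R * H k.+1 r).
  apply: is_deriveB; first exact: dnS.
  exact: (@is_deriveZ R _ _ _ k.+1%:R r 1 _ (dH k r)).
have := dM k.+1; rewrite E => -[_ e1]; have := d2 => -[_ e2].
move: e1; rewrite e2 mulr1 => /eqP; rewrite -subr_eq => /eqP <-.
by rewrite [k.+2%:R]mulrS mulrDl mul1r opprD addrAC addrA addrAC.
Qed.

(** Induction on the power of r, for all k at once: [HS] absorbs one factor r while lowering k, and
    [H0] absorbs it when k = 0. *)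
Let H_rapid k : rapid (H k).
Proof.
move=> j; elim: j k => [|j IH] k.
  have [M M0 HM] := f_bound k; exists M => r; rewrite expr0 mul1r.
  apply: le_trans (le_normr_Rintegral _ (f_int k r)) _ => //.
  have iM : mu.-integrable `[0, 1] (EFin \o cst M).
    apply: continuous_compact_integrable; first exact: segment_compact.
    by apply/continuous_subspaceT => x; exact: cvg_cst.
  have -> : M = \int[mu]_(t in `[0, 1]) cst M t.
    by rewrite Rintegral_cst//= lebesgue_measure_itv/= lte01 oppr0 addr0 mulr1.
  apply: le_Rintegral => //; first exact: (integrable_norm (f_int k r)).
  by move=> t; rewrite /= in_itv => /HM.
case: k => [|k].
  have [_ _ rg] := rschwartzW sg; have [M HM] := rg j; exists M => r.
  by rewrite exprSr -mulrA -normrM H0.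
have [M HM] := dn_rapid k.+1 j; have [N HN] := IH k.
exists (M + k.+1%:R * N) => r; rewrite exprSr -mulrA -normrM HS.
apply: le_trans (ler_wpM2l _ (ler_normB _ _)) _; first by rewrite exprn_ge0.
rewrite mulrDr lerD// normrM normr_nat mulrCA ler_wpM2l//.
Qed.

Lemma rschwartz_divX : exists2 h, rschwartz R h & forall r, g r = r * h r.
Proof.
exists (H 0); last by move=> r; rewrite H0.
(* The factor c closes the class under derivatives in all directions v of R, as ['D_v] is v times
   ['D_1]. *)
apply: (@rschwartz_sub _ _ [set h | exists c k, h = fun r => c * H k r]); last first.
  by exists 1, 0%N; apply/funext => r; rewrite mul1r.
move=> _ [c [k ->]].
have dcH r v : is_derive r v (fun r => c * H k r) (v * c * H k.+1 r).
  by rewrite -mulrA; apply/is_derive1_dir/(@is_deriveZ R _ _ _ c r 1 _ (dH k r)).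
have dcH1 r v : derivable (fun r => c * H k r) r v by have [] := dcH r v.
split => //.
- by move=> r; apply/differentiable_continuous/derivable1_diffP.
- move=> v; exists (v * c), k.+1; apply/funext => r; by case: (dcH r v).
- exact: rapidZ.
Qed.

End hadamard.

(** * Even Schwartz functions on the line *)

Section even_schwartz_fun.
Context {R : realType}.
Implicit Types psi chi : R -> R.

Definition reven : set (R -> R) :=
  [set psi | rschwartz R psi /\ forall r, psi (- r) = psi r].

Lemma linform_id : @linform R R id.
Proof.
split; first by move=> x; exact: cvg_id.
by split=> //; exists 1 => // x; rewrite mul1r.
Qed.

(** The derivative of an even function is odd, so it vanishes at 0 and can be divided by r; the
    quotient of two odd functions is even. *)
Lemma reven_derive psi : reven psi ->
  exists2 chi, reven chi & forall r : R, is_derive r 1 psi (r * chi r).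
Proof.
move=> [sp ep]; have [cp dp rp] := rschwartzW sp.
have odd r : 'D_1 psi (- r) = - 'D_1 psi r.
  have dN : is_derive (- r) 1 (-%R : R -> R) (-1) by exact: is_deriveNid.
  have dp' : is_derive (- - r) 1 psi ('D_1 psi (- - r)) by exact/derivableP.
  have [_] := @is_derive1_comp _ psi -%R _ _ _ dp' dN.
  rewrite opprK (_ : psi \o -%R = psi); last by apply/funext => x /=; rewrite ep.
  by rewrite mulrN1.
have D0 : 'D_1 psi 0 = 0.
  by have := odd 0; rewrite oppr0 => ?; lra.
have [h sh hE] := rschwartz_divX (rschwartzD1 (1 : R) sp) D0.
exists h; last by move=> r; rewrite -hE; exact/derivableP.
split => // r; have [->|r0] := eqVneq r 0; first by rewrite oppr0.
apply: (@mulfI _ (- r)); rewrite ?oppr_eq0// -hE odd hE mulNr//.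
Qed.

(* At [a = 0] the square root is not differentiable, but then [b = 0] and evenness
   gives [psi (sqrt c * `|t|) = psi (sqrt c * t)]. *)
Lemma derive_sqrt_quad psi chi (a b c : R) :
  (forall r, psi (- r) = psi r) -> (forall r : R, is_derive r 1 psi (r * chi r)) ->
  0 <= a -> 0 <= c -> (a = 0 -> b = 0) ->
  is_derive (0 : R) 1 (fun t => psi (Num.sqrt (a + 2 * b * t + c * t ^+ 2)))
    (b * chi (Num.sqrt a)).
Proof.
move=> ep dp; rewrite le_eqVlt => /predU1P[<-|a0] c0 ab.
  rewrite ab// mulr0 mul0r.
  have -> : (fun t => psi (Num.sqrt (0 + 0 * t + c * t ^+ 2))) =
      (fun t => psi (Num.sqrt c * t)).
    apply/funext => t; rewrite mul0r !add0r sqrtrM// sqrtr_sqr.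
    by have [t0|t0] := leP 0 t; [rewrite ger0_norm|rewrite ltr0_norm // mulrN ep].
  have d1 := is_derive_mul (Num.sqrt c) 0.
  have := @is_derive1_comp _ psi _ _ _ _ (dp _) d1.
  by rewrite !mulr0 !mul0r.
have dq : is_derive (0 : R) 1 (fun t : R => a + 2 * b * t + c * t ^+ 2) (2 * b).
  have -> : (fun t : R => a + 2 * b * t + c * t ^+ 2) =
      cst a + ( *%R (2 * b)) + ( *%R c) * ( *%R 1).
    by apply/funext => t; rewrite !fctE/=; ring.
  apply: (is_derive_eq (is_deriveD (is_deriveD (is_derive_cst a (0 : R) 1)
    (is_derive_mul (2 * b) 0)) (is_deriveM (is_derive_mul c 0) (is_derive_mul 1 0)))).
  by rewrite !mulr0 !scale0r add0r !addr0.
have q0 : 0 < a + 2 * b * 0 + c * 0 ^+ 2 by rewrite mulr0 expr0n mulr0 !addr0.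
pose q (t : R) := a + 2 * b * t + c * t ^+ 2.
have qE : q 0 = a by rewrite /q mulr0 expr0n mulr0 !addr0.
have ds := @is_derive1_comp _ Num.sqrt q _ _ _ (is_derive1_sqrt q0) dq.
apply: (is_derive_eq (@is_derive1_comp _ psi (Num.sqrt \o q) _ _ _ (dp _) ds)).
rewrite /= -/(q 0) qE.
have sa : Num.sqrt a != 0 by rewrite gt_eqF// sqrtr_gt0.
by field.
Qed.

End even_schwartz_fun.

(** * Radial extension *)

Lemma continuous_sum (R : realType) (T : topologicalType) (I : Type) (s : seq I)
    (F : I -> T -> R) : (forall i, continuous (F i)) ->
  continuous (fun x => \sum_(i <- s) F i x).
Proof.
move=> cF; elim: s => [|i s IH].
  by under eq_fun do rewrite big_nil; move=> x; exact: cvg_cst.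
by under eq_fun do rewrite big_cons; move=> x; apply: cvgD; [exact: cF|exact: IH].
Qed.

Section radial_extension.
Context {R : realType} {m : nat}.
Implicit Types (x y v : 'rV[R]_m) (psi chi : R -> R).

Lemma dot_linear v a x y : dot (a *: x + y) v = a * dot x v + dot y v.
Proof.
rewrite /dot mulr_sumr -big_split/=; apply: eq_bigr => i _.
by rewrite !mxE mulrDl mulrA.
Qed.

Lemma dotC x y : dot x y = dot y x.
Proof. by apply: eq_bigr => i _; rewrite mulrC. Qed.

Lemma dotDl x y v : dot (x + y) v = dot x v + dot y v.
Proof. by rewrite -{1}[x]scale1r dot_linear mul1r. Qed.

Lemma dot0l v : dot 0 v = 0.
Proof. by rewrite /dot big1// => i _; rewrite mxE mul0r. Qed.

Lemma dotZl a x v : dot (a *: x) v = a * dot x v.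
Proof. by rewrite -[a *: x]addr0 dot_linear dot0l addr0. Qed.

Lemma dotDr x y v : dot v (x + y) = dot v x + dot v y.
Proof. by rewrite dotC dotDl !(dotC _ v). Qed.

Lemma dotZr a x v : dot v (a *: x) = a * dot v x.
Proof. by rewrite dotC dotZl (dotC _ v). Qed.

Lemma dot_ge0 x : 0 <= dot x x.
Proof. by apply: sumr_ge0 => i _; rewrite -expr2 sqr_ge0. Qed.

Lemma enormZ a x : enorm (a *: x) = `|a| * enorm x.
Proof. by rewrite /enorm dotZl dotZr mulrA -expr2 sqrtrM ?sqr_ge0// sqrtr_sqr. Qed.

Lemma enorm_ge0 x : 0 <= enorm x.
Proof. exact: sqrtr_ge0. Qed.

Lemma sqr_enorm x : enorm x ^+ 2 = dot x x.
Proof. by rewrite sqr_sqrtr// dot_ge0. Qed.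

Lemma coord_le_norm x i : `|x 0 i| <= `|x|.
Proof.
rewrite [leRHS]mx_normrE; apply: le_trans (le_bigmax _ _ (0, i)) => //.
Qed.

Lemma norm_le_coord x : x = 0 \/ exists i, `|x| = `|x 0 i|.
Proof.
have [->|x0] := eqVneq x 0; [by left|right].
have : mx_norm x != 0 by apply: contra_neq x0; exact: mx_norm_eq0.
by move=> /mx_norm_neq0[[j i]] /= e; exists i; rewrite -(ord1 j).
Qed.

Lemma coord_le_enorm x i : `|x 0 i| <= enorm x.
Proof.
rewrite -sqrtr_sqr ler_wsqrtr// /dot (bigD1 i)//= -expr2 lerDl.
by apply: sumr_ge0 => j _; rewrite -expr2 sqr_ge0.
Qed.

Lemma norm_le_enorm x : `|x| <= enorm x.
Proof.
by have [->|[i ->]] := norm_le_coord x; [rewrite normr0 enorm_ge0|exact: coord_le_enorm].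
Qed.

Lemma linform_coord (i : 'I_m) : linform (fun x : 'rV[R]_m => x 0 i).
Proof.
split; first exact: coord_continuous.
split; first by move=> a x y; rewrite !mxE.
by exists 1 => // x; rewrite mul1r coord_le_norm.
Qed.

Lemma dot_continuous v : continuous (fun x => dot x v).
Proof.
apply: continuous_sum => i x.
by apply: continuousM; [exact: coord_continuous|exact: cst_continuous].
Qed.

Lemma linform_dot v : linform (fun x => dot x v).
Proof.
split; first exact: dot_continuous.
split; first by move=> a x y; rewrite dot_linear.
exists (\sum_i `|v 0 i|); first by apply: sumr_ge0.
move=> x; apply: le_trans (ler_norm_sum _ _ _) _.
rewrite mulr_suml; apply: ler_sum => i _.
by rewrite normrM mulrC ler_wpM2l// coord_le_norm.
Qed.

Lemma enorm_continuous : continuous (@enorm R m).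
Proof.
apply: continuousT_comp; last exact: sqrt_continuous.
apply: continuous_sum => i x.
by apply: continuousM; exact: coord_continuous.
Qed.

(** Along x + t v the squared Euclidean norm is x.x + 2 (x.v) t + (v.v) t^2, so [derive_sqrt_quad]
    applies, at the origin too. *)
Lemma is_derive_radial psi chi x v :
  (forall r, psi (- r) = psi r) -> (forall r : R, is_derive r 1 psi (r * chi r)) ->
  is_derive x v (fun y => psi (enorm y)) (dot x v * chi (enorm x)).
Proof.
move=> ep dp.
have ab : dot x x = 0 -> dot x v = 0.
  move=> xx; rewrite /dot big1// => i _; apply/eqP; rewrite mulf_eq0; apply/orP; left.
  by rewrite -normr_le0 (le_trans (coord_le_enorm x i))// /enorm xx sqrtr0.
have [dd dE] := derive_sqrt_quad ep dp (dot_ge0 x) (dot_ge0 v) ab.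
have E : (fun h : R => h^-1 *: (psi (enorm (h *: v + x)) - psi (enorm x))) =
    (fun h : R => h^-1 *: ((fun t => psi (Num.sqrt (dot x x + 2 * dot x v * t +
      dot v v * t ^+ 2))) (h *: 1 + 0) - psi (Num.sqrt (dot x x + 2 * dot x v * 0 +
      dot v v * 0 ^+ 2)))).
  apply/funext => h; congr (_ *: (psi (Num.sqrt _) - psi (Num.sqrt _))).
    rewrite addr0 [h *: 1]mulr1 dotDl !dotDr !dotZl !dotZr (dotC v x); ring.
  by rewrite expr0n !mulr0 !addr0.
by apply: DeriveDef; [rewrite /derivable E|rewrite /derive E].
Qed.

Lemma rapid_radial psi : rapid psi -> rapid (fun x => psi (enorm x)).
Proof.
move=> rp k; have [M HM] := rp k; exists M => x; apply: le_trans (HM (enorm x)).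
by rewrite ler_wpM2r// lerXn2r ?nnegrE// ger0_norm ?enorm_ge0// norm_le_enorm.
Qed.

(** The derivative (x.v) chi(|x|) is a linear form times a function of the same kind, so the radial
    functions of this form generate a module to which [polymod_rschwartz] applies. *)
Lemma rschwartz_radial psi : reven psi -> rschwartz 'rV[R]_m (fun x => psi (enorm x)).
Proof.
move=> epsi; apply: (@polymod_rschwartz _ _
    [set f | exists2 psi, reven psi & f = fun x => psi (enorm x)]); last first.
  by apply: polymod_base; exists psi.
move=> _ [{epsi}p ep ->]; have [[sp evp] [cp dp rp]] := (ep, rschwartzW ep.1).
have [chi echi dchi] := reven_derive ep.
have dr x v := is_derive_radial x v evp dchi; split.
- exact: continuousT_comp enorm_continuous cp.
- by move=> x v; have [] := dr x v.
- move=> v; rewrite (_ : 'D_v _ = fun x => dot x v * chi (enorm x)); last first.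
    by apply/funext => x; case: (dr x v).
  apply: polymodM; first exact: linform_dot.
  by apply: polymod_base; exists chi.
- exact: rapid_radial.
Qed.

End radial_extension.

(** * Lebesgue integrals over tuples *)

Section tuple_integrals.
Context {R : realType}.
Notation T := (measurableTypeR R).
Notation mu := (@lebesgue_measure R).

Lemma oneDsqr_gt0 (x : R) : 0 < oneDsqr x.
Proof. exact: lt_le_trans ltr01 (oneDsqr_ge1 x). Qed.

Lemma measurable_box m (q : 'I_m -> R) (e : R) :
  measurable [set x : m.-tuple T | forall i, `|q i - tnth x i| < e].
Proof.
rewrite (_ : [set _ | _] = \bigcap_(i in [set: 'I_m])
    ((fun x : m.-tuple T => tnth x i) @^-1` [set y | `|q i - y| < e])); last first.
  by apply/seteqP; split=> x /= => [h i _|h i]; [exact: h|exact: h i I].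
apply: fin_bigcap_measurable => // i _.
rewrite -[X in measurable X]setTI; apply: measurable_tnth => //.
rewrite (_ : [set y | _] = ball (q i) e)//; exact: measurable_ball.
Qed.

(** An open set is the countable union of the boxes with rational centre and radius 1 / (n + 1) that
    it contains. This links the topology of rows to the product sigma-algebra of tuples. *)
Lemma measurable_open_row m (O : set 'rV[R]_m) : open O ->
  measurable [set x : m.-tuple T | O (row_of_tuple x)].
Proof.
move=> oO; pose B (p : 'rV[rat]_m * nat) : set (m.-tuple T) :=
  [set x | forall i, `|ratr (p.1 0 i) - tnth x i| < p.2.+1%:R^-1].
pose P (p : 'rV[rat]_m * nat) := forall x, B p x -> O (row_of_tuple x).
rewrite (_ : [set _ | _] = \bigcup_p (if `[< P p >] then B p else set0)).
  apply: countable_bigcupT_measurable => [//|p]; case: ifPn => // _.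
  exact: measurable_box.
apply/seteqP; split=> [x /= Ox|x [p _]]; last first.
  by case: asboolP => // h; exact: h.
have /nbhs_ballP[e /= e0 he] : nbhs (row_of_tuple x) O by exact: open_nbhs_nbhs.
(* A radius below e / 2 keeps any two points of the box closer than e. *)
have [n _ /(_ n (leqnn n)) ne] := near_infty_natSinv_lt (PosNum (divr_gt0 e0 (ltr0n R 2))).
have /choice[q Hq] (i : 'I_m) : exists q : rat, `|ratr q - tnth x i| < n.+1%:R^-1.
  have lt : tnth x i < tnth x i + n.+1%:R^-1 by rewrite ltrDl invr_gt0.
  have [q] := rat_in_itvoo lt; rewrite in_itv/= => /andP[q1 q2]; exists q.
  by rewrite gtr0_norm ?subr_gt0// ltrBlDl.
exists (\row_i q i, n) => //; case: asboolP => [_ i|]; first by rewrite mxE.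
case=> y By; apply: he; split => //= i j; have := By j; rewrite !mxE/= => h.
rewrite /ball/=; have -> : tnth x j - tnth y j = (ratr (q j) - tnth y j) - (ratr (q j) - tnth x j) by ring.
apply: le_lt_trans (ler_normB _ _) _; rewrite (splitr e) ltrD//.
  by apply: lt_trans h _.
by apply: lt_trans (Hq j) _.
Qed.

Lemma measurable_row m (g : 'rV[R]_m -> R) : continuous g ->
  measurable_fun [set: m.-tuple T] (fun x => g (row_of_tuple x) : T).
Proof.
move=> /continuousP cg; apply: (measurability _ (RGenOpens.measurableE R)).
move=> _ [_ [a [b ->] <-]]; rewrite setTI.
exact: (measurable_open_row (cg _ (@interval_open _ _ _ _ _))).
Qed.

Lemma measurable_oneDsqrV : measurable_fun [set: T] (fun t : T => (oneDsqr t)^-1 : T).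
Proof.
by apply: (@continuous_measurable_fun R (fun t => (oneDsqr t)^-1)); exact: continuous_oneDsqrV.
Qed.

Lemma tnth_tuple_cons0 m (t : R) (x : m.-tuple T) : tnth (tuple_cons (t, x)) ord0 = t.
Proof. by rewrite (tnth_nth 0). Qed.

Lemma tnth_tuple_consS m (t : R) (x : m.-tuple T) i :
  tnth (tuple_cons (t, x)) (lift ord0 i) = tnth x i.
Proof. by rewrite !(tnth_nth 0). Qed.

(** Common dominating function: a product of integrable functions of one variable, so its integral
    is computed along [tuple_cons], while rapid decay puts every Schwartz function below a multiple
    of it. *)
Definition wt m (x : m.-tuple T) : R := \prod_(i < m) (oneDsqr (tnth x i))^-1.

Lemma wt_gt0 m (x : m.-tuple T) : 0 < wt x.
Proof. by apply: prodr_gt0 => i _; rewrite invr_gt0 oneDsqr_gt0. Qed.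

Lemma wt_cons m (t : R) (x : m.-tuple T) :
  wt (tuple_cons (t, x)) = (oneDsqr t)^-1 * wt x.
Proof.
rewrite /wt big_ord_recl; congr (_ * _).
by apply: eq_bigr => i _; rewrite tnth_tuple_consS.
Qed.

Lemma measurable_wt m : measurable_fun [set: m.-tuple T] (@wt m : _ -> T).
Proof.
apply: measurable_prod => i _; apply: (@measurableT_comp _ _ _ _ _ _ (fun t : T => (oneDsqr t)^-1 : T)).
  exact: measurable_oneDsqrV.
exact: measurable_tnth.
Qed.

Lemma measurable_wtE m :
  measurable_fun [set: m.-tuple T] (fun x : m.-tuple T => (wt x)%:E).
Proof. by apply/measurable_EFinP; exact: measurable_wt. Qed.

Local Open Scope ereal_scope.

Lemma ge0_integral_cons m (f : m.+1.-tuple T -> \bar R) :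
  measurable_fun setT f -> (forall x, 0 <= f x) ->
  \int[lebesgue_tuple m.+1]_x f x =
  \int[mu]_t \int[lebesgue_tuple m]_x f (tuple_cons (t, x)).
Proof.
move=> mf f0.
rewrite -[LHS]/(\int[pushforward (mu \x lebesgue_tuple m) (@tuple_cons R m)]_x f x).
rewrite ge0_integral_pushforward//.
rewrite preimage_setT (fubini_tonelli1 (f \o @tuple_cons R m))//.
  by apply: measurableT_comp => //; exact: measurable_tuple_cons.
by move=> x; exact: f0.
Qed.

Lemma integralT_oneDsqrV : \int[mu]_t ((oneDsqr t)^-1)%:E = (pi : R)%:E.
Proof.
rewrite ge0_symfun_integralT.
- rewrite -set_itvcy integral0y_oneDsqr -EFinM; congr EFin.
  by rewrite mulrC divfK.
- by move=> x; rewrite invr_ge0 (ltW (oneDsqr_gt0 _)).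
- exact: continuous_oneDsqrV.
- by move=> x; rewrite /oneDsqr/= sqrrN.
Qed.

Lemma integral_wt m : \int[lebesgue_tuple m]_x (@wt m x)%:E < +oo.
Proof.
elim: m => [|m IH].
  rewrite integral_dirac//; last exact: measurable_wtE.
  by rewrite diracE mem_set// -EFinM ltry.
rewrite ge0_integral_cons//; last 2 first.
- exact: measurable_wtE.
- by move=> x; rewrite lee_fin ltW// wt_gt0.
under eq_integral => t _.
  under eq_integral do rewrite wt_cons EFinM.
  rewrite ge0_integralZl_EFin//; last 2 first.
    by move=> x _; rewrite lee_fin ltW// wt_gt0.
    exact: measurable_wtE.
  over.
rewrite ge0_integralZr//; last 2 first.
- by apply/measurable_EFinP; exact: measurable_oneDsqrV.
- by apply: integral_ge0 => x _; rewrite lee_fin ltW// wt_gt0.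
by rewrite integralT_oneDsqrV lte_mul_pinfty// lee_fin pi_ge0.
Qed.

Lemma integrable_wt m : (lebesgue_tuple m).-integrable setT (EFin \o @wt m).
Proof.
apply/integrableP; split; first exact: measurable_wtE.
under eq_integral => x _ do rewrite /= gtr0_norm ?wt_gt0//.
exact: integral_wt.
Qed.

Local Close Scope ereal_scope.

Definition wtdom m (f : m.-tuple T -> R) := measurable_fun setT (f : _ -> T) /\
  exists2 M : R, 0 <= M & forall x, `|f x| <= M * wt x.

Lemma wtdom_integrable m (f : m.-tuple T -> R) : wtdom f ->
  (lebesgue_tuple m).-integrable setT (EFin \o f).
Proof.
move=> [mf [M M0 fM]].
apply: (@le_integrable _ _ _ _ _ measurableT _ (fun x => M%:E * (wt x)%:E)%E).
- exact/measurable_EFinP.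
- move=> x _; rewrite /= lee_fin (le_trans (fM x))// ger0_norm//.
  by rewrite mulr_ge0// ltW// wt_gt0.
- by apply: integrableZl => //; exact: integrable_wt.
Qed.

Lemma integrable_oneDsqrV (M : R) :
  mu.-integrable setT (fun t => (M * (oneDsqr t)^-1)%:E).
Proof.
under eq_fun do rewrite EFinM.
apply: integrableZl => //; apply/integrableP; split.
  by apply/measurable_EFinP; exact: measurable_oneDsqrV.
under eq_integral => t _ do rewrite /= ger0_norm ?invr_ge0 ?(ltW (oneDsqr_gt0 _))//.
by rewrite integralT_oneDsqrV ltry.
Qed.

Lemma integrable_le_oneDsqrV (f : R -> R) (M : R) :
  measurable_fun setT (f : T -> T) -> (forall t, `|f t| <= M * (oneDsqr t)^-1) ->
  mu.-integrable setT (EFin \o f).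
Proof.
move=> mf fM; apply: le_integrable (integrable_oneDsqrV M) => //.
  exact/measurable_EFinP.
by move=> t _; rewrite lee_fin; apply: le_trans (fM t) _; exact: ler_norm.
Qed.

(** Fubini. Integrating the bound M wt over the first coordinate leaves M pi wt, so the partial
    integral is dominated again and the lemma can be iterated. *)
Lemma wtdom_cons m (f : m.+1.-tuple T -> R) : wtdom f ->
  wtdom (fun x => \int[mu]_t f (tuple_cons (t, x))) /\
  \int[lebesgue_tuple m.+1]_x f x =
    \int[lebesgue_tuple m]_x \int[mu]_t f (tuple_cons (t, x)).
Proof.
move=> df; have [mf [M M0 fM]] := df.
have mfc : measurable_fun setT (f \o @tuple_cons R m : _ -> T).
  by apply: measurableT_comp => //; exact: measurable_tuple_cons.
have mfx x : measurable_fun setT (fun t : T => f (tuple_cons (t, x)) : T).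
  by apply: (measurableT_comp mfc); exact: measurable_pair2.
have fMx x t : `|f (tuple_cons (t, x))| <= (M * wt x) * (oneDsqr t)^-1.
  by apply: le_trans (fM _) _; rewrite wt_cons mulrCA mulrC.
have ifx x : mu.-integrable setT (fun t => (f (tuple_cons (t, x)))%:E).
  exact: (integrable_le_oneDsqrV (mfx x) (fMx x)).
have intf : (mu \x lebesgue_tuple m)%E.-integrable setT (EFin \o f \o @tuple_cons R m).
  apply/integrableP; split; first exact/measurable_EFinP.
  have /integrableP[_] := wtdom_integrable df.
  rewrite -[X in (X < _)%E -> _]/(\int[pushforward (mu \x lebesgue_tuple m)%E (@tuple_cons R m)]_x `|(f x)%:E|)%E.
  rewrite ge0_integral_pushforward//.
  by apply/measurableT_comp => //; exact/measurable_EFinP.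
split; last first.
  rewrite /Rintegral; congr fine.
  rewrite -[LHS]/(\int[pushforward (mu \x lebesgue_tuple m)%E (@tuple_cons R m)]_x (f x)%:E)%E.
  rewrite integral_pushforward//; last exact/measurable_EFinP.
  rewrite preimage_setT -(integral21_prod_meas1 intf).
  apply: eq_integral => x _; rewrite fineK//; exact: integrable_fin_num.
split.
  have := measurable_fubini_G intf; rewrite /fubini_G => mG.
  by exact: (measurableT_comp (@fine_measurable R _ measurableT) mG).
exists (M * pi) => [|x]; first by rewrite mulr_ge0 ?pi_ge0.
apply: le_trans (le_normr_Rintegral measurableT (ifx x)) _.
rewrite (_ : M * pi * wt x = \int[mu]_t (M * wt x * (oneDsqr t)^-1)).
  apply: le_Rintegral => //; [exact: integrable_norm (ifx x)|exact: integrable_oneDsqrV].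
rewrite RintegralZl//; last first.
  by have := integrable_oneDsqrV 1; under eq_fun do rewrite mul1r.
by rewrite /Rintegral integralT_oneDsqrV/= mulrAC.
Qed.

End tuple_integrals.

(** * Affine changes of variables *)

Section change_of_variables.
Context {R : realType}.
Notation T := (measurableTypeR R).
Notation mu := (@lebesgue_measure R).

Lemma measurable_affine (a c : R) : measurable_fun [set: T] (fun t : T => a * t + c : T).
Proof. by apply: measurable_funD => //; exact: measurable_funM. Qed.

Definition affine_map (a c : R) : T -> T := fun t => a * t + c.

Section affine.
Variables (a c : R).
Hypothesis a0 : a != 0.
Let phi := affine_map a c.
Let nu : {measure set T -> \bar R} := mscale (NngNum (normr_ge0 a))
  (measure_function_pushforward__canonical__measure_function_Measure
    mu (measurable_affine a c)).

(** By uniqueness of Lebesgue measure it suffices to compare the intervals ]x, y]; for a < 0 the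
    preimage is half-open on the other side, with the same length. *)
Let lebesgue_affine A : measurable A -> mu A = nu A.
Proof.
apply: lebesgue_measure_unique => _ [[x y] _ <-].
rewrite /nu/= /mscale/= /pushforward -/phi.
have [xy|yx] := ltP x y; last first.
  rewrite set_itv_ge ?bnd_simp ?le_gtF -?leNgt//.
  by rewrite preimage_set0 !measure0 mule0.
rewrite lebesgue_measure_itv/= lte_fin xy.
have [ap|an] := ltP 0 a.
  rewrite (_ : phi @^-1` _ = `]((x - c) / a), ((y - c) / a)]%classic); last first.
    apply/seteqP; split=> t /=; rewrite !in_itv/= /phi /affine_map ltr_pdivrMr// ler_pdivlMr//;
      by rewrite ltrBlDr lerBrDr [t * a]mulrC.
  rewrite lebesgue_measure_itv/= lte_fin ltr_pM2r ?invr_gt0// ltrD2r xy gtr0_norm//.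
  by rewrite -!EFinD -EFinM; congr EFin; field.
have {}an : a < 0 by rewrite lt_neqAle a0.
rewrite (_ : phi @^-1` _ = `[((y - c) / a), ((x - c) / a)[%classic); last first.
  apply/seteqP; split=> t /=; rewrite !in_itv/= /phi /affine_map ltr_ndivlMr// ler_ndivrMr//;
    by rewrite ltrBlDr lerBrDr [t * a]mulrC andbC.
rewrite lebesgue_measure_itv/= lte_fin ltr_nM2r ?invr_lt0// ltrD2r xy ltr0_norm//.
by rewrite -!EFinD -EFinM; congr EFin; field.
Qed.

Lemma ge0_integral_affine (f : T -> \bar R) : measurable_fun setT f ->
  (forall t, 0 <= f t)%E ->
  (\int[mu]_t f t = `|a|%:E * \int[mu]_t f (a * t + c)%R)%E.
Proof.
move=> mf f0; rewrite (eq_measure_integral nu); last by move=> A mA _; exact: lebesgue_affine.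
rewrite ge0_integral_mscale//; congr (_ * _)%E.
by rewrite (ge0_integral_pushforward (measurable_affine a c)).
Qed.

End affine.

Lemma integral_comp_eq d d' (X : measurableType d) (Y : measurableType d')
    (m1 : {measure set X -> \bar R}) (m2 : {measure set Y -> \bar R}) (phi : Y -> X) :
  (forall f : X -> \bar R, measurable_fun setT f -> (forall x, 0 <= f x)%E ->
    \int[m1]_x f x = \int[m2]_y f (phi y))%E ->
  forall f : X -> \bar R, measurable_fun setT f ->
    (\int[m1]_x f x = \int[m2]_y f (phi y))%E.
Proof.
move=> h f mf; rewrite [LHS]integralE [RHS]integralE.
rewrite (h _ (measurable_funepos mf))// (h _ (measurable_funeneg mf))//.
by congr (_ - _)%E; apply: eq_integral => y _; rewrite ?funeposE ?funenegE.
Qed.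

Lemma Rintegral_scale (a : R) (f : T -> R) : a != 0 -> measurable_fun setT f ->
  \int[mu]_t f t = \int[mu]_t (`|a| * f (a * t)).
Proof.
move=> a0 mf; have mf' : measurable_fun setT (fun t => (f t)%:E) by exact/measurable_EFinP.
have E (g : T -> \bar R) : measurable_fun setT g -> (forall x, 0 <= g x)%E ->
    (\int[mu]_t g t = \int[mu]_t (`|a|%:E * g (a * t)%R))%E.
  move=> mg g0; rewrite (ge0_integral_affine 0 a0 mg g0).
  under eq_integral do rewrite addr0.
  rewrite ge0_integralZl_EFin//.
  by apply: (measurableT_comp mg); exact: measurable_funM.
rewrite /Rintegral [in LHS]integralE [in RHS]integralE; congr (fine (_ - _)).
  rewrite (E _ (measurable_funepos mf'))//; apply: eq_integral => t _.
  by rewrite !funeposE EFinM maxeMr// mule0.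
rewrite (E _ (measurable_funeneg mf'))//; apply: eq_integral => t _.
by rewrite !funenegE EFinM -muleN maxeMr// mule0.
Qed.

(** One family for the two symmetries in use: translations for s = 1, and the reflection x |-> -x
    for s = -1 and c = 0. *)
Definition shift_tuple m (s : R) (c : 'I_m -> R) (x : m.-tuple T) : m.-tuple T :=
  [tuple s * tnth x i + c i | i < m].

Lemma measurable_shift_tuple m (s : R) (c : 'I_m -> R) :
  measurable_fun setT (shift_tuple s c).
Proof.
apply/measurable_fun_tnthP => i.
rewrite (_ : _ \o _ = fun x => s * tnth x i + c i); last first.
  by apply/funext => x /=; rewrite tnth_mktuple.
apply: (measurableT_comp (measurable_affine s (c i))); exact: measurable_tnth.
Qed.

Lemma ge0_integral_shift_tuple m (s : R) (c : 'I_m -> R) (f : m.-tuple T -> \bar R) :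
  `|s| = 1 -> measurable_fun setT f -> (forall x, 0 <= f x)%E ->
  (\int[lebesgue_tuple m]_x f x = \int[lebesgue_tuple m]_x f (shift_tuple s c x))%E.
Proof.
move=> s1; have s0 : s != 0 by rewrite -normr_eq0 s1 oner_eq0.
elim: m c f => [|m IH] c f mf f0.
  by apply: eq_integral => x _; congr f; rewrite [LHS]tuple0 [RHS]tuple0.
have mfs : measurable_fun setT (fun x => f (shift_tuple s c x)).
  by apply: measurableT_comp => //; exact: measurable_shift_tuple.
have mfc : measurable_fun setT (f \o @tuple_cons R m).
  by apply: measurableT_comp => //; exact: measurable_tuple_cons.
rewrite !ge0_integral_cons// (ge0_integral_affine (c ord0) s0); first last.
- by move=> t; exact: integral_ge0.
- apply: (measurable_fun_fubini_tonelli_F (f \o @tuple_cons R m)) => //.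
  by move=> x; exact: f0.
rewrite s1 mul1e; apply: eq_integral => t _.
rewrite (IH (fun i => c (lift ord0 i))); [|exact: (measurableT_comp mfc (measurable_pair1 _))|by []].
apply: eq_integral => x _; congr f; apply: eq_from_tnth => i.
rewrite tnth_mktuple; case: (unliftP ord0 i) => [j ->|->].
  by rewrite !tnth_tuple_consS tnth_mktuple.
by rewrite !tnth_tuple_cons0.
Qed.

Lemma Rintegral_shift_tuple m (s : R) (c : 'I_m -> R) (f : m.-tuple T -> R) :
  `|s| = 1 -> measurable_fun setT (f : _ -> T) ->
  \int[lebesgue_tuple m]_x f x = \int[lebesgue_tuple m]_x f (shift_tuple s c x).
Proof.
move=> s1 mf; rewrite /Rintegral; congr fine.
apply: (integral_comp_eq (phi := shift_tuple s c) _ (f := EFin \o f)).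
  by move=> g mg g0; exact: ge0_integral_shift_tuple.
exact/measurable_EFinP.
Qed.

End change_of_variables.

(** * Integrals of radial functions over the plane *)

Section planar_integral.
Context {R : realType}.
Notation T := (measurableTypeR R).
Notation mu := (@lebesgue_measure R).

Lemma Rintegral_even_antiderivative (f F : R -> R) (l : R) :
  (forall x, 0 <= f x) -> continuous f -> (forall x, f (- x) = f x) ->
  F x @[x --> +oo] --> l -> continuous F -> (forall x : R, 0 < x -> is_derive x 1 F (f x)) ->
  \int[mu]_x f x = 2 * (l - F 0).
Proof.
move=> f0 cf ef Fl cF dF; rewrite /Rintegral ge0_symfun_integralT//; last first.
  by move=> x /=; rewrite ef.
rewrite -set_itvcy (@ge0_continuous_FTC2y _ f F 0 l)//.
- by apply: continuous_subspaceT.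
- by move=> x x0; have [] := dF x x0.
- exact/cvg_at_right_filter/cF.
- by move=> x; rewrite in_itv/= andbT => x0; rewrite derive1E; have [] := dF x x0.
Qed.

Lemma continuous_quad (a b : R) : continuous (fun t : R => a + b * t ^+ 2).
Proof.
by move=> t; apply: cvgD; [exact: cvg_cst|apply: cvgM; [exact: cvg_cst|exact: exprn_continuous]].
Qed.

Lemma cvg_oneDsqrV_pinfty : (oneDsqr x)^-1 @[x --> +oo] --> (0 : R).
Proof.
apply/cvgrPdist_lt => e e0; near=> x.
rewrite sub0r normrN gtr0_norm ?invr_gt0 ?oneDsqr_gt0//.
have ex : e^-1 < x by near: x; apply: nbhs_pinfty_gt; rewrite num_real.
rewrite -[e]invrK ltf_pV2 ?posrE ?oneDsqr_gt0 ?invr_gt0//.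
apply: lt_le_trans ex _; rewrite /oneDsqr/=; have := sqr_ge0 (x - 1); nra.
Unshelve. all: by end_near. Qed.

Lemma rapid_oneDsqr_norm (V : normedModType R) (f : V -> R) k : rapid f ->
  exists2 M : R, 0 <= M & forall x, `|f x| * oneDsqr `|x| ^+ k <= M.
Proof.
move=> rf; have [M HM] := rf 0%N; have [N HN] := rf (2 * k)%N.
have M0 : 0 <= M by apply: le_trans (HM 0); rewrite mulr_ge0.
have N0 : 0 <= N by apply: le_trans (HN 0); rewrite mulr_ge0 ?exprn_ge0.
(* 1 + |x|^2 is at most 2 when |x| <= 1 and at most 2 |x|^2 otherwise; M serves the first case and N
   the second. *)
exists (2 ^+ k * (M + N)) => [|x]; first by rewrite mulr_ge0 ?addr_ge0 ?exprn_ge0.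
have f1 := HM x; rewrite expr0 mul1r in f1; have x0 := normr_ge0 x.
have [x1|x1] := leP `|x| 1.
  rewrite mulrC; apply: (@le_trans _ _ (2 ^+ k * M)).
    apply: ler_pM => //.
    rewrite lerXn2r ?nnegrE ?(ltW (oneDsqr_gt0 _))// /oneDsqr/=; nra.
  by rewrite ler_wpM2l ?exprn_ge0 ?lerDl.
apply: (@le_trans _ _ (`|f x| * (2 ^+ k * `|x| ^+ (2 * k)))).
  rewrite ler_wpM2l// exprM -exprMn lerXn2r ?nnegrE ?(ltW (oneDsqr_gt0 _))//.
  by rewrite /oneDsqr/=; nra.
rewrite mulrCA ler_wpM2l ?exprn_ge0// mulrC; apply: le_trans (HN x) _.
by rewrite lerDr.
Qed.

Lemma rapid_oneDsqr (f : R -> R) k : rapid f ->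
  exists2 M : R, 0 <= M & forall r, `|f r| * oneDsqr r ^+ k <= M.
Proof.
move=> /rapid_oneDsqr_norm-/(_ k)[M M0 HM]; exists M => // r.
by apply: le_trans (HM r); rewrite /oneDsqr/= real_normK ?num_real.
Qed.

(* The integrand has no sign: the fundamental theorem of calculus on [0, +oo[ for
   nonnegative functions is applied after adding a dominating function [g]. *)
Lemma Rintegral_abs_quad (psi chi : R -> R) (a b : R) : reven psi -> reven chi ->
  (forall r : R, is_derive r 1 psi (r * chi r)) -> 0 <= a -> 1 <= b ->
  mu.-integrable setT (fun t => (`|t| * chi (Num.sqrt (a + b * t ^+ 2)))%:E) /\
  \int[mu]_t (`|t| * chi (Num.sqrt (a + b * t ^+ 2))) = - 2 * psi (Num.sqrt a) * b^-1.
Proof.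
move=> [sp ep] [sc ec] dpsi a0 b1.
have [[cp _ rp] [cc _ rc]] := (rschwartzW sp, rschwartzW sc).
have [M M0 HM] := rapid_oneDsqr 2 rc; have [N N0 HN] := rapid_oneDsqr 1 rp.
have b0 : 0 < b by exact: lt_le_trans ltr01 b1.
pose q (t : R) : R := a + b * t ^+ 2.
have q0 t : 0 <= q t by apply: addr_ge0 => //; apply: mulr_ge0; [exact: ltW|exact: sqr_ge0].
have qt t : oneDsqr t <= oneDsqr (Num.sqrt (q t)).
  rewrite /oneDsqr/= lerD2l sqr_sqrtr// /q; have := sqr_ge0 t; nra.
have cq : continuous (fun t => Num.sqrt (q t)).
  exact: (continuousT_comp (@continuous_quad a b) (@sqrt_continuous R)).
pose f (t : R) : R := `|t| * chi (Num.sqrt (q t)).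
(* Besides dominating f, this function has the elementary antiderivative [G]; hence the exponent 2
   in the decay of chi. *)
pose g (t : R) : R := `|t| * M * (oneDsqr t)^-1 ^+ 2.
have cf : continuous f.
  exact: (continuousTM (@norm_continuous _ R) (continuousT_comp cq cc)).
have cg : continuous g.
  apply: (continuousTM (f := fun t => `|t| * M)).
    exact: (continuousTM (@norm_continuous _ R) (@cst_continuous _ _ M)).
  exact: (continuousT_comp (@continuous_oneDsqrV R) (@exprn_continuous _ 2)).
have fg t : `|f t| <= g t.
  rewrite /f /g normrM normr_id -mulrA ler_wpM2l// exprVn ler_pdivlMr; last first.
    by rewrite exprn_gt0 ?oneDsqr_gt0.
  apply: le_trans (HM (Num.sqrt (q t))); rewrite ler_wpM2l// lerXn2r ?nnegrE//;
  exact/ltW/oneDsqr_gt0.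
have g0 t : 0 <= g t by apply: le_trans (fg t).
have gM t : `|g t| <= M * (oneDsqr t)^-1.
  have o0 := oneDsqr_gt0 t.
  have -> : `|g t| = (`|t| * (oneDsqr t)^-1) * (M * (oneDsqr t)^-1).
    by rewrite ger0_norm// /g; ring.
  rewrite -[leRHS]mul1r; apply: ler_wpM2r; first by rewrite mulr_ge0// invr_ge0 ltW.
  rewrite ler_pdivrMr// mul1r /oneDsqr/= -[t ^+ 2]real_normK ?num_real//.
  have := sqr_ge0 (`|t| - 1); have := normr_ge0 t; nra.
have ig : mu.-integrable setT (EFin \o g).
  apply: integrable_le_oneDsqrV gM; exact: continuous_measurable_fun.
have if_ : mu.-integrable setT (EFin \o f).
  apply: (@integrable_le_oneDsqrV _ f M) => [|t]; first exact: continuous_measurable_fun.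
  by apply: le_trans (fg t) (le_trans (ler_norm _) (gM t)).
split; first exact: if_.
pose F (t : R) : R := psi (Num.sqrt (q t)) * b^-1.
pose G (t : R) : R := - (M / 2) * (oneDsqr t)^-1.
have cF : continuous F.
  exact: (continuousTM (continuousT_comp cq cp) (@cst_continuous _ _ b^-1)).
have cG : continuous G.
  exact: (continuousTM (@cst_continuous _ _ (- (M / 2))) (@continuous_oneDsqrV R)).
have G0 : G x @[x --> +oo] --> (0 : R).
  rewrite -(mulr0 (- (M / 2))); apply: cvgM; first exact: cvg_cst.
  exact: cvg_oneDsqrV_pinfty.
have F0 : F x @[x --> +oo] --> (0 : R).
  have lim0 c : c * (oneDsqr x)^-1 @[x --> +oo] --> (0 : R).
    by rewrite -(mulr0 c); apply: cvgM; [exact: cvg_cst|exact: cvg_oneDsqrV_pinfty].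
  apply: (squeeze_cvgr _ (lim0 (- N)) (lim0 N)); apply: nearW => t.
  rewrite mulNr -ler_norml /F normrM ler_pdivlMr ?oneDsqr_gt0// -[leRHS]mulr1 mulrAC.
  apply: ler_pM => //.
    by apply: le_trans (HN (Num.sqrt (q t))); rewrite expr1 ler_wpM2l.
  by rewrite ger0_norm ?invr_ge0 ?(ltW b0)// invf_le1.
have dF (t : R) : 0 < t -> is_derive t 1 F (f t).
  (* Recentring at t: q(t + s) = q(t) + 2 (b t) s + b s^2, so [derive_sqrt_quad], stated at 0, gives
     the derivative at t. *)
  move=> t0; pose p s := psi (Num.sqrt (q t + 2 * (b * t) * s + b * s ^+ 2)).
  have dp : is_derive (0 : R) 1 p (b * t * chi (Num.sqrt (q t))).
    apply: derive_sqrt_quad => //; first exact: ltW.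
    by move=> qt0; move: (q0 t); rewrite /q in qt0 *; nra.
  have ds : is_derive t 1 (fun s : R => s - t) 1.
    by apply: (is_derive_eq (is_deriveB (is_derive_id t 1) (is_derive_cst t t 1))); rewrite subr0.
  rewrite -(subrr t) in dp; pose sh (s : R) : R := s - t.
  have := is_deriveM (@is_derive1_comp _ p sh _ _ _ dp ds) (is_derive_cst b^-1 t 1).
  rewrite (_ : _ * _ = F); last first.
    apply/funext => s; rewrite /F /p /sh !fctE/=; congr (psi (Num.sqrt _) * _).
    by rewrite /q; ring.
  move=> h; apply: (is_derive_eq h); rewrite scaler0 add0r /GRing.scale/= /f gtr0_norm//.
  by field; rewrite gt_eqF.
have dG (t : R) : 0 < t -> is_derive t 1 G (g t).
  move=> t0; have dsq : is_derive t 1 (@oneDsqr R) (2 * t).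
    rewrite (_ : oneDsqr = cst 1 + ( *%R 1) * ( *%R 1)); last first.
      by apply/funext => s; rewrite /oneDsqr !fctE/= !mul1r expr2.
    apply: (is_derive_eq (is_deriveD (is_derive_cst (1 : R) t 1)
      (is_deriveM (is_derive_mul 1 t) (is_derive_mul 1 t)))).
    by rewrite /GRing.scale/=; ring.
  have o0 : oneDsqr t != 0 by rewrite gt_eqF ?oneDsqr_gt0.
  have := is_deriveM (is_derive_cst (- (M / 2)) t 1) (is_deriveV o0 dsq).
  move=> h; apply: (is_derive_eq h); rewrite scaler0 addr0 /GRing.scale/= /g gtr0_norm//.
  by field.
have even_q t : q (- t) = q t by rewrite /q sqrrN.
have even_o t : oneDsqr (- t) = oneDsqr t by rewrite /oneDsqr/= sqrrN.
have e1 : \int[mu]_t g t = 2 * (0 - G 0).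
  apply: Rintegral_even_antiderivative => // t; first by rewrite /g normrN even_o.
have e2 : \int[mu]_t (f t + g t) = 2 * (0 - (F 0 + G 0)).
  apply: (@Rintegral_even_antiderivative (fun t => f t + g t) (fun t => F t + G t)).
  - by move=> t; have := fg t; rewrite ler_norml => /andP[+ _]; rewrite -subr_ge0 opprK addrC.
  - exact: continuousTD cf cg.
  - by move=> t; rewrite /f /g normrN even_q even_o.
  - by rewrite -(addr0 0); exact: cvgD.
  - exact: continuousTD cF cG.
  - by move=> t t0; apply: is_deriveD; [exact: dF|exact: dG].
have : \int[mu]_t (f t + g t) = \int[mu]_t f t + \int[mu]_t g t by rewrite RintegralD.
rewrite e1 e2 => e3.
have -> : \int[mu]_t f t = 2 * (0 - (F 0 + G 0)) - 2 * (0 - G 0) by rewrite e3 addrK.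
by rewrite /F /q expr0n mulr0 addr0; ring.
Qed.

End planar_integral.

Section planar_radial_integral.
Context {R : realType}.
Notation T := (measurableTypeR R).
Notation mu := (@lebesgue_measure R).

Lemma integrable_prod (f : T * T -> R) (C : R) :
  measurable_fun setT (f : _ -> T) ->
  (forall t, \int[mu]_s `|(f (t, s))%:E| <= (C * (oneDsqr t)^-1)%:E)%E ->
  (mu \x mu)%E.-integrable setT (EFin \o f).
Proof.
move=> mf fC; have mfE : measurable_fun setT (EFin \o f) by exact/measurable_EFinP.
apply/(integrable12ltyP mu mu mfE).
have /integrableP[mo] := integrable_oneDsqrV (R := R) C; apply: le_lt_trans.
apply: ge0_le_integral => //.
- by move=> t _; exact: integral_ge0.
- apply: (measurable_fun_fubini_tonelli_F (fun x => `|(f x)%:E|%E)) => //.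
  exact: measurableT_comp.
- exact: measurableT_comp.
- by move=> t _; apply: le_trans (fC t) _; rewrite lee_fin ler_norm.
Qed.

Lemma integrable_section1 (f : T * T -> R) (C : R) (t : T) :
  measurable_fun setT (f : _ -> T) ->
  (\int[mu]_s `|(f (t, s))%:E| <= C%:E)%E ->
  mu.-integrable setT (fun s => (f (t, s))%:E).
Proof.
move=> mf fC; apply/integrableP; split; last exact: le_lt_trans fC (ltry _).
by apply/measurable_EFinP; apply: (measurableT_comp mf); exact: measurable_pair1.
Qed.

Lemma Rfubini (f : T * T -> R) :
  (forall t, mu.-integrable setT (fun s => (f (t, s))%:E)) ->
  (forall s, mu.-integrable setT (fun t => (f (t, s))%:E)) ->
  (mu \x mu)%E.-integrable setT (EFin \o f) ->
  \int[mu]_t \int[mu]_s f (t, s) = \int[mu]_s \int[mu]_t f (t, s).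
Proof.
move=> i1 i2 i12; rewrite /Rintegral; congr fine.
transitivity (\int[mu]_t \int[mu]_s (f (t, s))%:E)%E.
  by apply: eq_integral => t _; rewrite fineK//; exact: integrable_fin_num.
rewrite [LHS](Fubini i12); apply: eq_integral => s _.
by rewrite fineK//; exact: integrable_fin_num.
Qed.

(* The substitution [s = t * u] plays the part of polar coordinates; the angular
   integral is then [int 1 / (1 + u^2) du = pi]. *)
Lemma planar_radial_integral (psi chi : R -> R) (a : R) : reven psi -> reven chi ->
  (forall r : R, is_derive r 1 psi (r * chi r)) -> 0 <= a ->
  \int[mu]_t \int[mu]_s chi (Num.sqrt (a + s ^+ 2 + t ^+ 2)) =
  - 2 * pi * psi (Num.sqrt a).
Proof.
move=> epsi echi dpsi a0.
have [cc _ rc] := rschwartzW echi.1.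
have [M M0 HM] := rapid_oneDsqr 2 rc.
have msq : measurable_fun [set: T] (Num.sqrt : T -> T).
  by apply: continuous_measurable_fun; exact: sqrt_continuous.
have mchi : measurable_fun [set: T] (fun r => chi (Num.sqrt r) : T).
  by apply: (measurableT_comp _ msq); exact: continuous_measurable_fun.
pose h (p : T * T) : T := chi (Num.sqrt (a + p.2 ^+ 2 + p.1 ^+ 2)).
pose K (p : T * T) : T := `|p.1| * chi (Num.sqrt (a + (oneDsqr p.2) * p.1 ^+ 2)).
have mh : measurable_fun setT h.
  apply: (measurableT_comp mchi); apply: measurable_funD; last exact: measurable_funX.
  by apply: measurable_funD => //; exact: measurable_funX.
have mK : measurable_fun setT K.
  apply: measurable_funM; first exact: measurableT_comp.
  apply: (measurableT_comp mchi); apply: measurable_funD => //.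
  apply: measurable_funM; last exact: measurable_funX.
  by apply: measurable_funD => //; exact: measurable_funX.
have hM t s : `|h (t, s)| <= M * (oneDsqr t)^-1 * (oneDsqr s)^-1.
  rewrite -mulrA -invfM ler_pdivlMr ?mulr_gt0 ?oneDsqr_gt0//.
  apply: le_trans (HM (Num.sqrt (a + s ^+ 2 + t ^+ 2))); rewrite ler_wpM2l//.
  have ? := sqr_ge0 s; have ? := sqr_ge0 t.
  rewrite /oneDsqr/= sqr_sqrtr ?addr_ge0//; nra.
have mu1 (f : T -> T) t : measurable_fun setT f ->
    (forall s, `|f s| <= M * (oneDsqr t)^-1 * (oneDsqr s)^-1) ->
    (\int[mu]_s `|(f s)%:E| <= (M * pi * (oneDsqr t)^-1)%:E)%E.
  move=> mf fM; apply: (@le_trans _ _ (\int[mu]_s (M * (oneDsqr t)^-1 * (oneDsqr s)^-1)%:E)%E).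
    apply: ge0_le_integral => //.
    - by apply: measurableT_comp => //; exact/measurable_EFinP.
    - by apply/measurable_EFinP; apply: measurable_funM => //; exact: measurable_oneDsqrV.
    - by move=> s _; rewrite lee_fin.
  under eq_integral do rewrite EFinM.
  rewrite ge0_integralZl_EFin//.
  - by rewrite integralT_oneDsqrV -EFinM lee_fin mulrAC.
  - by apply/measurable_EFinP; exact: measurable_oneDsqrV.
  - by rewrite mulr_ge0// invr_ge0 ltW// oneDsqr_gt0.
have msec (f : T * T -> T) t : measurable_fun setT f -> measurable_fun setT (fun s => f (t, s)).
  by move=> mf; apply: (measurableT_comp mf); exact: measurable_pair1.
have h1 t : (\int[mu]_s `|(h (t, s))%:E| <= (M * pi * (oneDsqr t)^-1)%:E)%E.
  by apply: mu1; [exact: msec|exact: hM].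
have hK t u : K (t, u) = `|t| * h (t, t * u).
  by rewrite /K /h/=; congr (_ * chi (Num.sqrt _)); rewrite /oneDsqr/=; ring.
have K1 t : (\int[mu]_s `|(K (t, s))%:E| <= (M * pi * (oneDsqr t)^-1)%:E)%E.
  have [->|t0] := eqVneq t 0.
    rewrite integral0_eq; last by move=> s _; rewrite /K/= normr0 mul0r normr0.
    by rewrite lee_fin !mulr_ge0 ?pi_ge0// invr_ge0 ltW// oneDsqr_gt0.
  apply: le_trans (h1 t).
  have mah : measurable_fun setT (fun s => `|(h (t, s))%:E|%E).
    by apply: measurableT_comp => //; apply/measurable_EFinP; exact: msec.
  rewrite (ge0_integral_affine 0 t0 mah)//.
  under [in leRHS]eq_integral do rewrite addr0.
  rewrite -ge0_integralZl_EFin//.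
    apply: ge0_le_integral => //.
    - by apply: measurableT_comp => //; apply/measurable_EFinP; exact: msec.
    - apply: measurable_funeM; apply: (measurableT_comp mah); exact: measurable_funM.
    - by move=> s _; rewrite hK -EFinM lee_fin normrM normr_id.
  by apply: (measurableT_comp mah); exact: measurable_funM.
(* For fixed u the integrand is that of [Rintegral_abs_quad] with b = 1 + u^2; the factor 1 / b it
   leaves is the angular density. *)
have K2 u : mu.-integrable setT (fun t => (K (t, u))%:E) /\
    \int[mu]_t K (t, u) = - 2 * psi (Num.sqrt a) * (oneDsqr u)^-1.
  by apply: Rintegral_abs_quad => //; exact: oneDsqr_ge1.
have ih := integrable_prod mh h1; have iK := integrable_prod mK K1.
have ih1 t := integrable_section1 mh (h1 t).
have iK1 t := integrable_section1 mK (K1 t).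
transitivity (\int[mu]_t \int[mu]_u K (t, u)).
  (* The substitution s = t u degenerates at t = 0, so the inner integrals are compared outside this
     null set. *)
  rewrite /Rintegral; congr fine; apply: ae_eq_integral => //.
  - rewrite (_ : (fun _ => _) = fubini_F mu (EFin \o h)); last first.
      by apply/funext => t; rewrite fineK//; exact: integrable_fin_num (ih1 t).
    exact: (measurable_fubini_F ih).
  - rewrite (_ : (fun _ => _) = fubini_F mu (EFin \o K)); last first.
      by apply/funext => t; rewrite fineK//; exact: integrable_fin_num (iK1 t).
    exact: (measurable_fubini_F iK).
  exists [set 0]; split => //; first exact: lebesgue_measure_set1.
  move=> t /= ht; apply: contrapT => t0; apply: ht => _; congr (_%:E).
  rewrite -[LHS]/(\int[mu]_s h (t, s)) -[RHS]/(\int[mu]_s K (t, s)).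
  rewrite (@Rintegral_scale _ t (fun s => h (t, s)))//; [|exact/eqP|exact: msec].
  by apply: eq_Rintegral => u _; rewrite hK.
rewrite Rfubini//; last by move=> u; exact: (K2 u).1.
under eq_Rintegral do rewrite (K2 _).2.
rewrite RintegralZl//; last first.
  by have := integrable_oneDsqrV (R := R) 1; under eq_fun do rewrite mul1r.
by rewrite /Rintegral integralT_oneDsqrV/= mulrAC.
Qed.

End planar_radial_integral.

(** * Cosine and sine transforms *)

Section tuple_functions.
Context {R : realType}.
Notation T := (measurableTypeR R).

(** In the sup norm each 1 + x_i^2 is at most 1 + |x|^2, so decay like (1 + |x|^2)^-m is enough. *)
Lemma rschwartz_wtdom m (g : 'rV[R]_m -> R) : rschwartz 'rV[R]_m g ->
  wtdom (fun x : m.-tuple T => g (row_of_tuple x)).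
Proof.
move=> sg; have [cg _ /(rapid_oneDsqr_norm m)[M M0 HM]] := rschwartzW sg.
split; first exact: measurable_row.
exists M => // x; rewrite /wt prodfV ler_pdivlMr; last first.
  by apply: prodr_gt0 => i _; exact: oneDsqr_gt0.
apply: le_trans (HM (row_of_tuple x)); rewrite ler_wpM2l//.
have -> : oneDsqr `|row_of_tuple x| ^+ m = \prod_(i < m) oneDsqr `|row_of_tuple x|.
  by rewrite prodr_const card_ord.
apply: ler_prod => i _; rewrite (ltW (oneDsqr_gt0 _))/= /oneDsqr/= lerD2l.
rewrite -[leLHS]real_normK ?num_real// lerXn2r ?nnegrE//.
by have := coord_le_norm (row_of_tuple x) i; rewrite mxE.
Qed.

Lemma wtdomM m (f b : m.-tuple T -> R) : wtdom f -> measurable_fun setT (b : _ -> T) ->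
  (forall x, `|b x| <= 1) -> wtdom (fun x => f x * b x).
Proof.
move=> [mf [M M0 fM]] mb b1; split; first exact: measurable_funM.
exists M => // x; rewrite normrM -[leRHS]mulr1 ler_pM//.
Qed.

Lemma wtdomD m (f g : m.-tuple T -> R) : wtdom f -> wtdom g ->
  wtdom (fun x => f x + g x).
Proof.
move=> [mf [M M0 fM]] [mg [N N0 gN]]; split; first exact: measurable_funD.
exists (M + N) => [|x]; first exact: addr_ge0.
by rewrite mulrDl; apply: le_trans (ler_normD _ _) (lerD _ _).
Qed.

Lemma wtdomZ m (c : R) (f : m.-tuple T -> R) : wtdom f -> wtdom (fun x => c * f x).
Proof.
move=> [mf [M M0 fM]]; split; first exact: measurable_funM.
exists (`|c| * M) => [|x]; first exact: mulr_ge0.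
by rewrite normrM -mulrA ler_wpM2l.
Qed.

(** Peetre's inequality 1 + y^2 <= 2 (1 + c^2) (1 + (y + c)^2) in each coordinate. The constant
    depends on v alone, which makes the bound uniform over small translations, as domination under
    the integral sign requires. *)
Lemma wt_shift m (c v : 'I_m -> R) (x : m.-tuple T) :
  (forall i, `|c i| <= `|v i|) ->
  wt (shift_tuple 1 c x) <= (\prod_i (2 * oneDsqr (v i))) * wt x.
Proof.
move=> cv; rewrite /wt -big_split/=; apply: ler_prod => i _.
rewrite invr_ge0 (ltW (oneDsqr_gt0 _))/= tnth_mktuple mul1r.
rewrite ler_pdivlMr ?oneDsqr_gt0// mulrC ler_pdivrMr ?oneDsqr_gt0//.
have : c i ^+ 2 <= v i ^+ 2.
  by rewrite -[leLHS]real_normK ?num_real// -[leRHS]real_normK ?num_real// lerXn2r ?nnegrE.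
rewrite /oneDsqr/=; move: (c i) (v i) (tnth x i) => a b y ab.
have h1 : 0 <= (y + 2 * a) ^+ 2 by exact: sqr_ge0.
have h2 : 0 <= a ^+ 2 by exact: sqr_ge0.
have h3 : 0 <= (y + a) ^+ 2 by exact: sqr_ge0.
have h4 : 0 <= (b ^+ 2 - a ^+ 2) * (1 + (y + a) ^+ 2) by rewrite mulr_ge0 ?subr_ge0 ?addr_ge0.
have h5 : 0 <= a ^+ 2 * (y + a) ^+ 2 by rewrite mulr_ge0.
nra.
Qed.

End tuple_functions.

Section derive_affine.
Context {R : realType} {V : normedModType R}.

Lemma derive_affine_line (g : V -> R) (e x : V) (r : R) :
  derivable g (r *: e + x) e ->
  is_derive r 1 (fun t : R => g (t *: e + x)) ('D_e g (r *: e + x)).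
Proof.
move=> dg; have E : (fun h : R => h^-1 *: (g ((h *: 1 + r) *: e + x) - g (r *: e + x)))
    @ 0^' --> 'D_e g (r *: e + x).
  move: dg; rewrite /derivable/derive => /cvg_ex[l lc].
  have := lc => /cvg_lim -> //.
  by under eq_fun do rewrite [_ *: 1]mulr1 scalerDl -addrA.
by apply: DeriveDef; [apply/cvg_ex; eexists; exact: E|exact/cvg_lim].
Qed.

End derive_affine.

Section trigonometric_transform.
Context {R : realType} {m : nat}.
Notation T := (measurableTypeR R).
Notation V := 'rV[R]_m.
Notation lam := (@lebesgue_tuple R m).
Implicit Types (g h : V -> R) (xi v : V) (k : R -> R).

(* The Fourier transform of a real function [g] is [trT cos g - i * trT sin g]. *)
Definition trT k g xi : R :=
  \int[lam]_x (g (row_of_tuple x) * k (2 * pi * dot (row_of_tuple x) xi)).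

Lemma eq_trT k g h xi : (forall x, g x = h x) -> trT k g xi = trT k h xi.
Proof. by move=> gh; apply: eq_Rintegral => x _; rewrite gh. Qed.

(** What cos, sin and -sin share: statements about transforms are proved once for a kernel k with
    derivative k'. *)
Definition wave k := continuous k /\ forall s, `|k s| <= 1.

Lemma wave_cos : wave cos.
Proof.
split; first exact: continuous_cos.
by move=> s; rewrite ler_norml cos_geN1 cos_le1.
Qed.

Lemma wave_sin : wave sin.
Proof.
split; first exact: continuous_sin.
by move=> s; rewrite ler_norml sin_geN1 sin_le1.
Qed.

Lemma wave_sinN : wave (fun s => - sin s).
Proof.
have [cs s1] := wave_sin; split=> [s|s]; last by rewrite normrN.
by apply: cvgN; exact: cs.
Qed.

Lemma wave_measurable k xi : wave k -> measurable_fun setT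
  (fun x : m.-tuple T => k (2 * pi * dot (row_of_tuple x) xi) : T).
Proof.
move=> [ck _]; apply: (@measurable_row _ _ (fun y => k (2 * pi * dot y xi))).
apply: (continuousT_comp (f := fun y : V => 2 * pi * dot y xi) _ ck).
by apply: continuousTM; [exact: cst_continuous|exact: dot_continuous].
Qed.

Lemma trT_wtdom k g xi : wave k -> rschwartz V g ->
  wtdom (fun x : m.-tuple T => g (row_of_tuple x) * k (2 * pi * dot (row_of_tuple x) xi)).
Proof.
move=> wk sg; apply: wtdomM; [exact: rschwartz_wtdom|exact: wave_measurable|].
by move=> x; exact: wk.2.
Qed.

Lemma trT_integrable k g xi : wave k -> rschwartz V g -> lam.-integrable setT
  (EFin \o (fun x => g (row_of_tuple x) * k (2 * pi * dot (row_of_tuple x) xi))).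
Proof. by move=> wk sg; apply: wtdom_integrable; exact: trT_wtdom. Qed.

Lemma trTZ k c g xi : wave k -> rschwartz V g ->
  trT k (fun x => c * g x) xi = c * trT k g xi.
Proof.
move=> wk sg; rewrite -RintegralZl//; last exact: trT_integrable.
by apply: eq_Rintegral => x _; rewrite mulrA.
Qed.

Lemma trTD k g h xi : wave k -> rschwartz V g -> rschwartz V h ->
  trT k (fun x => g x + h x) xi = trT k g xi + trT k h xi.
Proof.
move=> wk sg sh; rewrite -RintegralD//; [|exact: trT_integrable..].
by apply: eq_Rintegral => x _; rewrite mulrDl.
Qed.

Lemma trT_sinN g xi : trT (fun s => - sin s) g xi = trT sin (fun x => -1 * g x) xi.
Proof. by apply: eq_Rintegral => x _; rewrite mulN1r mulrN mulNr. Qed.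

Lemma trT_bound k g : wave k -> rschwartz V g ->
  forall xi, `|trT k g xi| <= \int[lam]_x `|g (row_of_tuple x)|.
Proof.
move=> wk sg xi; apply: le_trans (le_normr_Rintegral measurableT (trT_integrable xi wk sg)) _.
apply: le_Rintegral => //.
- exact: integrable_norm (trT_integrable xi wk sg).
- exact: integrable_norm (wtdom_integrable (rschwartz_wtdom sg)).
- by move=> x _; rewrite normrM -[leRHS]mulr1 ler_wpM2l// wk.2.
Qed.

(** Differentiation under the integral sign along a curve: straight lines give the directional
    derivatives of the transform, circles its constancy on spheres. The bound K on the velocity
    yields a dominating function independent of s. *)
Lemma derive_trT k (k' : R -> R) g (gam gam' : R -> V) (K : R) (t : R) :
  wave k -> wave k' -> (forall s : R, is_derive s 1 k (k' s)) -> rschwartz V g ->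
  (forall (s : R) i, is_derive s 1 (fun s => gam s 0 i) (gam' s 0 i)) ->
  (forall s i, `|gam' s 0 i| <= K) ->
  is_derive t 1 (fun s => trT k g (gam s))
    (2 * pi * trT k' (fun x => dot x (gam' t) * g x) (gam t)).
Proof.
move=> wk wk' dk sg dgam gamK.
pose f (s : R) (x : m.-tuple T) : R :=
  g (row_of_tuple x) * k (2 * pi * dot (row_of_tuple x) (gam s)).
pose f' (s : R) (x : m.-tuple T) : R :=
  2 * pi * (dot (row_of_tuple x) (gam' s) * g (row_of_tuple x) *
  k' (2 * pi * dot (row_of_tuple x) (gam s))).
have ddot (s : R) (y : V) : is_derive s 1 (fun s => dot y (gam s)) (dot y (gam' s)).
  rewrite /dot (_ : (fun s => _) = \sum_(i < m) (fun s => y 0 i * gam s 0 i)); last first.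
    by apply/funext => u; rewrite fct_sumE.
  by apply: is_derive_sum => i; exact: (is_deriveZ (y 0 i) (dgam s i)).
have df (s : R) x : is_derive s 1 (f ^~ x) (f' s x).
  pose p (u : R) : R := 2 * pi * dot (row_of_tuple x) (gam u).
  have d1 : is_derive s 1 p (2 * pi * dot (row_of_tuple x) (gam' s)).
    exact: (is_deriveZ (2 * pi) (ddot s (row_of_tuple x))).
  have := is_deriveZ (g (row_of_tuple x)) (@is_derive1_comp _ k p _ _ _ (dk _) d1).
  move=> d; apply: (is_derive_eq d); rewrite /f' /GRing.scale/= /p; ring.
pose G x : R := 2 * pi * \sum_(i < m) (K * `|row_of_tuple x 0 i * g (row_of_tuple x)|).
have K0 (i : 'I_m) : 0 <= K by apply: le_trans (gamK 0 i).
have pi2 : 0 <= 2 * pi :> R by rewrite mulr_ge0 ?pi_ge0.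
have G0 x : 0 <= G x.
  by rewrite mulr_ge0// sumr_ge0// => i _; rewrite mulr_ge0// (K0 i).
have iG : lam.-integrable setT (EFin \o G).
  apply: wtdom_integrable; apply: wtdomZ; elim: (index_enum _) => [|i s IH].
    under eq_fun do rewrite big_nil; split; first exact: measurable_cst.
    by exists 0 => // x; rewrite normr0 mul0r.
  under eq_fun do rewrite big_cons; apply: wtdomD => //; apply: wtdomZ.
  have [mf [M M0 fM]] := rschwartz_wtdom (rschwartzM (linform_coord i) sg).
  split; first exact: measurableT_comp.
  by exists M => // x; rewrite normr_id.
have Gub s x : `|f' s x| <= G x.
  rewrite /f' /G normrM (ger0_norm pi2) ler_wpM2l// normrM.
  apply: (@le_trans _ _ (`|dot (row_of_tuple x) (gam' s) * g (row_of_tuple x)| * 1)).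
    by rewrite ler_wpM2l// wk'.2.
  rewrite mulr1 /dot mulr_suml; apply: le_trans (ler_norm_sum _ _ _) _.
  apply: ler_sum => i _; rewrite mulrAC normrM mulrC ler_wpM2r//.
have mI : measurable ([set: m.-tuple T]) by [].
have ti : `]t - 1, t + 1[%classic t.
  by rewrite /= in_itv/= ltrDl ltr01 andbT gtrBl ltr01.
have fi x : `]t - 1, t + 1[%classic x -> lam.-integrable setT (EFin \o f x).
  by move=> _; exact: trT_integrable.
have d1E : partial1of2 f = f'.
  apply/funext => s; apply/funext => y; rewrite partial1of2E.
  by case: (df s y).
have dd x y : `]t - 1, t + 1[%classic x -> setT y -> derivable (f ^~ y) x 1.
  by move=> _ _; case: (df x y).
have Gub' x y : `]t - 1, t + 1[%classic x -> setT y -> `|partial1of2 f x y| <= G y.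
  by rewrite d1E => _ _; exact: Gub.
apply: DeriveDef.
  exact: (derivable_under_integral mI ti fi dd G0 iG Gub').
rewrite -derive1E (differentiation_under_integral mI ti fi dd G0 iG Gub') d1E.
rewrite /trT -RintegralZl//.
apply: (@trT_integrable _ (fun y => dot y (gam' t) * g y)) => //.
by apply: rschwartzM => //; exact: linform_dot.
Qed.

(* By translation invariance, [int h(x + s v) dx] does not depend on [s] for
   [h x = g x * k (2 pi x.xi)]. *)
Lemma trT_derive k (k' : R -> R) g v xi : wave k -> wave k' ->
  (forall s : R, is_derive s 1 k (k' s)) -> rschwartz V g ->
  trT k ('D_v g) xi = - (2 * pi * dot v xi) * trT k' g xi.
Proof.
move=> wk wk' dk sg; have [cg dg _] := rschwartzW sg.
pose h (y : V) : R := g y * k (2 * pi * dot y xi).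
pose h' (y : V) : R := 'D_v g y * k (2 * pi * dot y xi) + (2 * pi * dot v xi) * (g y * k' (2 * pi * dot y xi)).
have dh (s : R) y : is_derive s 1 (fun t : R => h (t *: v + y)) (h' (s *: v + y)).
  have d1 := derive_affine_line (dg (s *: v + y) v).
  pose p (t : R) : R := 2 * pi * dot (t *: v + y) xi.
  have d2 : is_derive s 1 p (2 * pi * dot v xi).
    rewrite (_ : p = ( *%R (2 * pi * dot v xi)) + cst (2 * pi * dot y xi)); last first.
      by apply/funext => t; rewrite /p dot_linear !fctE; ring.
    apply: (is_derive_eq (is_deriveD (is_derive_mul (2 * pi * dot v xi) s)
      (is_derive_cst (2 * pi * dot y xi) s 1))).
    by rewrite addr0.
  have d := is_deriveM d1 (@is_derive1_comp _ k p _ _ _ (dk _) d2).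
  apply: (is_derive_eq d); rewrite /h' /GRing.scale/= /p; ring.
have wh : wtdom (fun x : m.-tuple T => h (row_of_tuple x)) by exact: trT_wtdom.
have wh' : wtdom (fun x : m.-tuple T => h' (row_of_tuple x)).
  exact: (wtdomD (trT_wtdom xi wk (rschwartzD1 v sg))
    (wtdomZ (2 * pi * dot v xi) (trT_wtdom xi wk' sg))).
have [mh' [M M0 HM]] := wh'.
pose C := \prod_(i < m) (2 * oneDsqr (v 0 i)).
have C0 : 0 <= C by apply: prodr_ge0 => i _; rewrite mulr_ge0 ?(ltW (oneDsqr_gt0 _)).
pose sh (s : R) (x : m.-tuple T) := shift_tuple 1 (fun i => s * v 0 i) x.
have shE s x : row_of_tuple (sh s x) = s *: v + row_of_tuple x.
  by apply/rowP => i; rewrite !mxE tnth_mktuple mul1r addrC.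
pose f (s : R) (x : m.-tuple T) : R := h (s *: v + row_of_tuple x).
have mI : measurable ([set: m.-tuple T]) by [].
have ti : `]-1, 1[%classic (0 : R) by rewrite /= in_itv/= ltrN10 ltr01.
have fsh s : (lam).-integrable setT (EFin \o f s) /\ \int[lam]_x f s x = \int[lam]_x f 0 x.
  have fE x : f s x = h (row_of_tuple (sh s x)) by rewrite shE.
  split; last first.
    under eq_Rintegral do rewrite fE.
    under [RHS]eq_Rintegral do rewrite /f scale0r add0r.
    exact/esym/(Rintegral_shift_tuple _ (normr1 _) wh.1).
  apply: wtdom_integrable; have [mh [N N0 HN]] := wh; split.
    rewrite (_ : f s = fun x => h (row_of_tuple (sh s x))); last exact/funext.
    exact: (measurableT_comp mh (measurable_shift_tuple _ _)).
  exists (N * \prod_(i < m) (2 * oneDsqr (s * v 0 i))) => [|x].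
    by rewrite mulr_ge0// prodr_ge0.
  by rewrite fE -mulrA; apply: le_trans (HN _) _; rewrite ler_wpM2l//; exact: wt_shift.
have d1E : partial1of2 f = fun s x => h' (s *: v + row_of_tuple x).
  apply/funext => s; apply/funext => y; rewrite partial1of2E.
  by case: (dh s (row_of_tuple y)).
have Gub x y : `]-1, 1[%classic x -> setT y -> `|partial1of2 f x y| <= M * (C * wt y).
  rewrite d1E => /=; rewrite in_itv/= => /andP[x1 x2] _.
  rewrite -shE; apply: le_trans (HM _) _; rewrite ler_wpM2l//.
  apply: wt_shift => i; rewrite normrM -[leRHS]mul1r ler_wpM2r//.
  by rewrite ler_norml !ltW.
have iG : lam.-integrable setT (EFin \o (fun y => M * (C * wt y))).
  apply: wtdom_integrable; do 2 apply: wtdomZ; split; first exact: measurable_wt.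
  by exists 1 => // x; rewrite mul1r ger0_norm// ltW// wt_gt0.
have G0 (y : m.-tuple T) : 0 <= M * (C * wt y) by rewrite !mulr_ge0// ltW// wt_gt0.
have dd x y : `]-1, 1[%classic x -> setT y -> derivable (f ^~ y) x 1.
  by move=> _ _; case: (dh x (row_of_tuple y)).
have := differentiation_under_integral mI ti (fun x _ => (fsh x).1) dd G0 iG Gub.
rewrite (_ : (fun _ => _) = cst (\int[lam]_x f 0 x)); last first.
  by apply/funext => s; rewrite (fsh s).2.
rewrite derive1_cst d1E => /esym.
under eq_Rintegral do rewrite scale0r add0r.
rewrite RintegralD//; first last.
- by apply: wtdom_integrable; apply: wtdomZ; exact: trT_wtdom.
- exact: (trT_integrable xi wk (rschwartzD1 v sg)).
rewrite RintegralZl//; last exact: (trT_integrable xi wk' sg).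
by rewrite -/(trT k ('D_v g) xi) -/(trT k' g xi) mulNr => /eqP; rewrite addr_eq0 => /eqP.
Qed.

End trigonometric_transform.

Lemma lipschitz_continuous (R : realType) (V : normedModType R) (f : V -> R) (L : R) :
  0 <= L -> (forall x y, `|f x - f y| <= L * `|x - y|) -> continuous f.
Proof.
move=> L0 HL x; apply/cvgrPdist_lt => e e0; near=> y.
apply: le_lt_trans (HL _ _) _.
have : `|x - y| < e / (L + 1).
  by near: y; apply: cvgr_dist_lt; [exact: cvg_id|rewrite divr_gt0// ltr_wpDl].
rewrite ltr_pdivlMr ?ltr_wpDl// => h; apply: le_lt_trans h.
by rewrite mulrDr mulr1 [L * _]mulrC lerDl.
Unshelve. all: by end_near. Qed.

(** * Regularity and decay of the transforms *)

Section transform_schwartz.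
Context {R : realType} {m : nat}.
Notation T := (measurableTypeR R).
Notation V := 'rV[R]_m.
Notation lam := (@lebesgue_tuple R m).
Implicit Types (g h : V -> R) (xi eta v : V) (k : R -> R).

Lemma derive_trT_dir k (k' : R -> R) g v xi : wave k -> wave k' ->
  (forall s : R, is_derive s 1 k (k' s)) -> rschwartz V g ->
  is_derive xi v (trT k g) (2 * pi * trT k' (fun x => dot x v * g x) xi).
Proof.
move=> wk wk' dk sg; pose gam (t : R) : V := t *: v + xi.
have dgam (s : R) i : is_derive s 1 (fun s => gam s 0 i) (v 0 i).
  rewrite (_ : (fun _ => _) = ( *%R^~ (v 0 i)) + cst (xi 0 i)); last first.
    by apply/funext => t; rewrite /gam !mxE.
  apply: (is_derive_eq (is_deriveD (is_derive_mulC (v 0 i) s) (is_derive_cst (xi 0 i) s 1))).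
  by rewrite addr0.
have := @derive_trT _ _ _ _ g gam (fun=> v) `|v| 0 wk wk' dk sg dgam (fun _ => coord_le_norm v).
have -> : gam 0 = xi by rewrite /gam scale0r add0r.
move=> [+ +]; rewrite /derivable/derive.
have E : (fun h : R => h^-1 *: ((trT k g \o gam) (h *: 1 + 0) - (trT k g \o gam) 0)) =
    (fun h : R => h^-1 *: (trT k g (h *: v + xi) - trT k g xi)).
  by apply/funext => s; rewrite /= /gam addr0 [s *: 1]mulr1 scale0r add0r.
by rewrite E => d1 d2; exact: DeriveDef.
Qed.

(** Derivability in every direction does not imply continuity. The mean value theorem on the segment
    from eta to xi does, because the derivative there is at most |xi - eta| times a constant
    independent of the point. *)
Lemma trT_lipschitz k (k' : R -> R) g : wave k -> wave k' ->
  (forall s : R, is_derive s 1 k (k' s)) -> rschwartz V g ->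
  exists2 L : R, 0 <= L & forall xi eta, `|trT k g xi - trT k g eta| <= L * `|xi - eta|.
Proof.
move=> wk wk' dk sg.
pose N (i : 'I_m) : R := \int[lam]_x `|row_of_tuple x 0 i * g (row_of_tuple x)|.
have N0 i : 0 <= N i by apply: Rintegral_ge0.
exists (2 * pi * \sum_i N i); first by rewrite !mulr_ge0 ?pi_ge0// sumr_ge0.
move=> xi eta; pose v := xi - eta; pose gam (t : R) : V := t *: v + eta.
have bnd y : `|trT k' (fun x => dot x v * g x) y| <= `|v| * \sum_i N i.
  have -> : trT k' (fun x => dot x v * g x) y =
      \sum_i v 0 i * trT k' (fun x => x 0 i * g x) y.
    rewrite /dot; elim: (index_enum _) => [|i s IH].
      rewrite big_nil; transitivity (0 * trT k' g y); last by rewrite mul0r.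
      by rewrite -trTZ//; apply: eq_Rintegral => x _; rewrite big_nil.
    rewrite big_cons -IH -trTZ//; last by apply: rschwartzM => //; exact: linform_coord.
    rewrite -trTD//.
    - by apply: eq_Rintegral => x _; rewrite big_cons; ring.
    - by apply: rschwartzZ; apply: rschwartzM => //; exact: linform_coord.
    - under eq_fun do rewrite mulr_suml; apply: rschwartz_sum => j.
      under eq_fun do rewrite mulrAC [_ * v 0 j]mulrC.
      by apply: rschwartzZ; apply: rschwartzM => //; exact: linform_coord.
  apply: le_trans (ler_norm_sum _ _ _) _; rewrite mulr_sumr; apply: ler_sum => i _.
  rewrite normrM ler_pM// ?coord_le_norm//; apply: trT_bound => //.
  by apply: rschwartzM => //; exact: linform_coord.
have dg (t : R) : is_derive t 1 (fun s => trT k g (gam s))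
    (2 * pi * trT k' (fun x => dot x v * g x) (gam t)).
  apply: (@derive_trT _ _ k k' g gam (fun=> v) `|v|) => // [s i|s i]; last exact: coord_le_norm.
  rewrite (_ : (fun _ => _) = ( *%R^~ (v 0 i)) + cst (eta 0 i)); last first.
    by apply/funext => u; rewrite /gam !mxE.
  apply: (is_derive_eq (is_deriveD (is_derive_mulC (v 0 i) s) (is_derive_cst (eta 0 i) s 1))).
  by rewrite addr0.
have cg : {within `[0, 1], continuous (fun s => trT k g (gam s))}.
  apply: continuous_subspaceT => t; apply/differentiable_continuous/derivable1_diffP.
  by case: (dg t).
have [c _] := MVT_segment ler01 (fun t _ => dg t) cg.
rewrite /gam scale1r scale0r add0r subrK subr0 mulr1 => ->.
rewrite normrM ger0_norm ?mulr_ge0 ?pi_ge0// -mulrA ler_wpM2l ?mulr_ge0 ?pi_ge0//.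
by rewrite mulrC; exact: bnd.
Qed.

Lemma trT_continuous k (k' : R -> R) g : wave k -> wave k' ->
  (forall s : R, is_derive s 1 k (k' s)) -> rschwartz V g -> continuous (trT k g).
Proof.
move=> wk wk' dk sg; have [L L0 HL] := trT_lipschitz wk wk' dk sg.
exact: lipschitz_continuous L0 HL.
Qed.

Lemma dot_delta (i : 'I_m) xi : dot (delta_mx 0 i) xi = xi 0 i.
Proof.
rewrite /dot (bigD1 i)//= mxE !eqxx mul1r big1 ?addr0// => j ji.
by rewrite mxE (negbTE ji) mul0r.
Qed.

(** Each factor xi_i is traded for a derivative of g by integration by parts, the extra factor 2 pi
    >= 1 being dropped. This exchanges the two kernels, so the bounds for cosine and sine are
    carried through the induction together. *)
Lemma trT_coord_rapid (i : 'I_m) (p : nat) g : rschwartz V g ->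
  exists2 M : R, 0 <= M & forall xi,
    `|xi 0 i| ^+ p * `|trT cos g xi| <= M /\ `|xi 0 i| ^+ p * `|trT sin g xi| <= M.
Proof.
elim: p g => [|p IH] g sg.
  exists (\int[lam]_x `|g (row_of_tuple x)|); first exact: Rintegral_ge0.
  by move=> xi; rewrite !expr0 !mul1r; split; apply: trT_bound => //;
    [exact: wave_cos|exact: wave_sin].
have [M M0 HM] := IH _ (rschwartzD1 (delta_mx 0 i) sg).
have pi1 : 1 <= 2 * pi :> R by have := pi_ge2 R; lra.
exists M => // xi; have [hc hs] := HM xi.
have key a b : a = - (2 * pi * xi 0 i) * b -> `|xi 0 i| * `|b| <= `|a|.
  move=> ->; rewrite mulNr normrN 2!normrM (ger0_norm (le_trans ler01 pi1)) -mulrA.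
  by rewrite ler_peMl// mulr_ge0.
split; rewrite exprSr -mulrA.
  apply: le_trans hs; rewrite ler_wpM2l ?exprn_ge0//; apply: key.
  by rewrite (trT_derive _ _ wave_sin wave_cos)// dot_delta.
apply: le_trans hc; rewrite ler_wpM2l ?exprn_ge0// -(normrN (trT sin g xi)); apply: key.
rewrite (trT_derive _ _ wave_cos wave_sinN)// dot_delta trT_sinN trTZ//; last exact: wave_sin.
by rewrite mulN1r.
Qed.

Lemma trT_rapid g : rschwartz V g -> rapid (trT cos g) /\ rapid (trT sin g).
Proof.
move=> sg; suff H (p : nat) : exists2 M : R, 0 <= M & forall xi,
    `|xi| ^+ p * `|trT cos g xi| <= M /\ `|xi| ^+ p * `|trT sin g xi| <= M.
  by split=> p; have [M M0 HM] := H p; exists M => xi; have [] := HM xi.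
have /choice[M HM] (i : 'I_m) : exists M : R, 0 <= M /\ forall xi,
    `|xi 0 i| ^+ p * `|trT cos g xi| <= M /\ `|xi 0 i| ^+ p * `|trT sin g xi| <= M.
  by have [M M0 HM] := trT_coord_rapid i p sg; exists M.
(* [N] takes care of xi = 0, where [norm_le_coord] yields no coordinate, as always when m = 0. *)
pose N := \int[lam]_x `|g (row_of_tuple x)|.
have N0 : 0 <= N by exact: Rintegral_ge0.
have S0 : 0 <= \sum_i M i by apply: sumr_ge0 => i _; exact: (HM i).1.
exists (\sum_i M i + N); first exact: addr_ge0.
move=> xi; have [->|[i ->]] := norm_le_coord xi; last first.
  have Mi : M i <= \sum_i M i + N.
    rewrite (bigD1 i)//= -addrA lerDl addr_ge0// sumr_ge0// => j _; exact: (HM j).1.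
  by have [h1 h2] := (HM i).2 xi; split; [exact: le_trans h1 Mi|exact: le_trans h2 Mi].
have n1 : `|0 : V| ^+ p <= 1 by rewrite normr0 expr0n; case: eqP.
have key k : wave k -> `|0 : V| ^+ p * `|trT k g 0| <= \sum_i M i + N.
  move=> wk; apply: (@le_trans _ _ (1 * N)); last by rewrite mul1r lerDr.
  by apply: ler_pM => //; exact: trT_bound.
by split; apply: key; [exact: wave_cos|exact: wave_sin].
Qed.

Let deriv_cos (s : R) : is_derive s 1 cos (- sin s). Proof. exact: is_derive_cos. Qed.
Let deriv_sin (s : R) : is_derive s 1 sin (cos s). Proof. exact: is_derive_sin. Qed.

(** Differentiation exchanges the kernels, so the closed class consists of sums of a cosine and a
    sine transform: g and h become multiples of (x.v) h and (x.v) g. *)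
Lemma rschwartz_trT g h : rschwartz V g -> rschwartz V h ->
  rschwartz V (fun xi => trT cos g xi + trT sin h xi).
Proof.
move=> sg sh; apply: (@rschwartz_sub _ _ [set f | exists g h, [/\ rschwartz V g,
  rschwartz V h & f = fun xi => trT cos g xi + trT sin h xi]]); last by exists g, h.
move=> _ [{sg}g [{sh}h [sg sh ->]]].
have dc xi v := derive_trT_dir v xi wave_cos wave_sinN deriv_cos sg.
have ds xi v := derive_trT_dir v xi wave_sin wave_cos deriv_sin sh.
split.
- exact: (continuousTD (trT_continuous wave_cos wave_sinN deriv_cos sg)
    (trT_continuous wave_sin wave_cos deriv_sin sh)).
- by move=> x v; apply: derivableD; [case: (dc x v)|case: (ds x v)].
- move=> v; exists (fun x => 2 * pi * (dot x v * h x)), (fun x => - (2 * pi) * (dot x v * g x)).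
  split; [by apply: rschwartzZ; apply: rschwartzM => //; exact: linform_dot..|].
  apply/funext => xi; case: (is_deriveD (dc xi v) (ds xi v)) => _ ->.
  have sd f : rschwartz V f -> rschwartz V (fun x => dot x v * f x).
    by move=> sf; apply: rschwartzM => //; exact: linform_dot.
  rewrite trT_sinN !trTZ//; [|by [exact: wave_sin|exact: wave_cos|exact: sd]..].
  by rewrite mulN1r mulrN mulNr addrC.
- by apply: rapidD; [exact: (trT_rapid sg).1|exact: (trT_rapid sh).2].
Qed.

End transform_schwartz.

(** * Transforms of radial functions *)

Section radial_transform.
Context {R : realType} {m : nat}.
Notation T := (measurableTypeR R).
Notation V := 'rV[R]_m.
Notation lam := (@lebesgue_tuple R m).
Implicit Types (g h : V -> R) (xi eta v w : V) (psi chi : R -> R).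

(** The reflection x |-> -x changes the sign of the integrand. *)
Lemma trT_sin_even g xi : rschwartz V g -> (forall x, g (- x) = g x) ->
  trT sin g xi = 0.
Proof.
move=> sg eg; pose f (x : m.-tuple T) : R :=
  g (row_of_tuple x) * sin (2 * pi * dot (row_of_tuple x) xi).
have [mf _] : wtdom f by exact: (trT_wtdom xi wave_sin sg).
have n1 : `|-1 : R| = 1 by rewrite normrN normr1.
have e : trT sin g xi = - trT sin g xi.
  rewrite [LHS](Rintegral_shift_tuple (fun=> 0) n1 mf) -[RHS]mulN1r.
  rewrite -(trTZ _ _ wave_sin sg); apply: eq_Rintegral => x _; rewrite /f.
  have -> : row_of_tuple (shift_tuple (-1) (fun=> 0) x) = - row_of_tuple x.
    by apply/rowP => i; rewrite !mxE tnth_mktuple addr0 mulN1r.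
  by rewrite eg -[- row_of_tuple x]scaleN1r dotZl mulN1r mulrN sinN mulN1r mulrN mulNr.
lra.
Qed.

Lemma derive_dotM g v w : rschwartz V g ->
  'D_v (fun x => dot x w * g x) = (fun x => dot v w * g x + dot x w * 'D_v g x).
Proof.
move=> sg; have [_ dg _] := rschwartzW sg; apply/funext => x.
case: (is_deriveM (is_derive_linform x v (linform_dot w)) (derivableP (dg x v))) => _ ->.
by rewrite addrC [g x *: _]mulrC.
Qed.

Lemma derive_radial psi chi v x : reven psi ->
  (forall r : R, is_derive r 1 psi (r * chi r)) ->
  'D_v (fun x : V => psi (enorm x)) x = dot x v * chi (enorm x).
Proof. by move=> [_ ep] dp; case: (is_derive_radial x v ep dp). Qed.

Lemma derive_radialE psi chi v : reven psi ->
  (forall r : R, is_derive r 1 psi (r * chi r)) ->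
  'D_v (fun x : V => psi (enorm x)) = (fun x => dot x v * chi (enorm x)).
Proof. by move=> ep dp; apply/funext => x; exact: derive_radial. Qed.

Let deriv_cos (s : R) : is_derive s 1 cos (- sin s). Proof. exact: is_derive_cos. Qed.
Let deriv_sin (s : R) : is_derive s 1 sin (cos s). Proof. exact: is_derive_sin. Qed.

(* Both [eta]-derivative of [(x.w) psi(|x|)] and [w]-derivative of
   [(x.eta) psi(|x|)] equal [(eta.w) psi + (x.eta)(x.w) chi]. *)
Lemma trT_tangent psi eta w : reven psi -> dot eta w = 0 -> 0 < dot eta eta ->
  trT sin (fun x => dot x w * psi (enorm x)) eta = 0.
Proof.
move=> ep ew e0; have [chi ec dp] := reven_derive ep.
have sp := @rschwartz_radial R m _ ep.
have sM v : rschwartz V (fun x => dot x v * psi (enorm x)).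
  by apply: rschwartzM => //; exact: linform_dot.
have e1 : trT cos ('D_eta (fun x => dot x w * psi (enorm x))) eta =
    trT cos ('D_w (fun x => dot x eta * psi (enorm x))) eta.
  rewrite (derive_dotM eta w sp) (derive_dotM w eta sp).
  apply: eq_trT => x.
  by rewrite !(derive_radial _ _ ep dp) (dotC w eta); ring.
(* Integration by parts produces the factor eta.eta on the left and eta.w = 0 on the right. *)
move: e1; rewrite (trT_derive eta eta wave_cos wave_sinN deriv_cos (sM w)).
rewrite (trT_derive w eta wave_cos wave_sinN deriv_cos (sM eta)) (dotC w eta) ew mulr0 oppr0 mul0r.
rewrite trT_sinN trTZ//; last exact: wave_sin.
move=> /eqP; rewrite mulN1r mulrN oppr_eq0 mulf_eq0 oppr_eq0 mulf_eq0 (gt_eqF e0) orbF.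
by rewrite mulf_eq0 pnatr_eq0 (gt_eqF (pi_gt0 R))/= => /eqP.
Qed.

Lemma trT_cosN g xi : trT cos g (- xi) = trT cos g xi.
Proof.
by apply: eq_Rintegral => x _; rewrite -scaleN1r dotZr mulN1r mulrN cosN.
Qed.

(** Since xi and q are orthogonal of equal length, the curve is a circle whose velocity is
    orthogonal to its position; by [trT_tangent] the derivative of the transform along it is
    zero. *)
Lemma trT_cos_circle psi xi q (th : R) : reven psi -> 0 < dot xi xi ->
  dot xi q = 0 -> dot q q = dot xi xi ->
  trT cos (fun x => psi (enorm x)) (cos th *: xi + sin th *: q) =
  trT cos (fun x => psi (enorm x)) xi.
Proof.
move=> ep x0 xq qq; pose gam (t : R) : V := cos t *: xi + sin t *: q.
pose gam' (t : R) : V := - sin t *: xi + cos t *: q.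
have dgam (s : R) i : is_derive s 1 (fun s => gam s 0 i) (gam' s 0 i).
  rewrite (_ : (fun _ => _) = cos * cst (xi 0 i) + sin * cst (q 0 i)); last first.
    by apply/funext => t; rewrite /gam !mxE.
  apply: (is_derive_eq (is_deriveD
    (is_deriveM (deriv_cos s) (is_derive_cst (xi 0 i) s 1))
    (is_deriveM (deriv_sin s) (is_derive_cst (q 0 i) s 1)))).
  by rewrite !mxE !scaler0 !add0r /GRing.scale/=; ring.
have gamK s i : `|gam' s 0 i| <= `|xi| + `|q|.
  rewrite !mxE; apply: le_trans (ler_normD _ _) _; rewrite lerD// normrM -[leRHS]mul1r.
    by rewrite ler_pM ?coord_le_norm ?normrN ?(wave_sin.2).
  by rewrite ler_pM ?coord_le_norm ?(wave_cos.2).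
have sp := @rschwartz_radial R m _ ep.
have d0 (s : R) : is_derive s 1 (fun s => trT cos (fun x => psi (enorm x)) (gam s)) 0.
  apply: (is_derive_eq (derive_trT s wave_cos wave_sinN deriv_cos sp dgam gamK)).
  rewrite trT_sinN trTZ//; last 2 first.
  - exact: wave_sin.
  - by apply: rschwartzM => //; exact: linform_dot.
  rewrite trT_tangent ?mulr0//.
    by rewrite /gam /gam' !dotDl !dotDr !dotZl !dotZr (dotC q xi) xq qq; ring.
  rewrite /gam !dotDl !dotDr !dotZl !dotZr (dotC q xi) xq qq !mulr0 addr0 add0r !mulrA.
  by rewrite -mulrDl -!expr2 cos2Dsin2 mul1r.
have := is_derive_0_is_cst th 0 d0.
by rewrite /gam cos0 sin0 scale1r scale0r addr0.
Qed.

(** Two vectors of equal length lie on a circle in a plane through 0: write zeta = c xi + d with d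
    orthogonal to xi. Then c is the cosine of the angle, and d rescaled to the length of xi is the
    second axis. *)
Lemma trT_cos_radial psi xi (zeta : V) : reven psi -> enorm xi = enorm zeta ->
  trT cos (fun x => psi (enorm x)) xi = trT cos (fun x => psi (enorm x)) zeta.
Proof.
move=> ep exz; have xz : dot xi xi = dot zeta zeta by rewrite -!sqr_enorm exz.
have enorm0 v : dot v v = 0 -> v = 0.
  move=> vv; apply/rowP => i; rewrite mxE; apply/eqP; rewrite -normr_le0.
  by rewrite (le_trans (coord_le_enorm v i))// /enorm vv sqrtr0.
have [r0|rn0] := eqVneq (dot xi xi) 0.
  by rewrite (enorm0 _ r0) (enorm0 zeta)// -xz.
have r0 : 0 < dot xi xi by rewrite lt_neqAle eq_sym rn0 dot_ge0.
pose c : R := dot xi zeta / dot xi xi.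
have cE : dot xi zeta = c * dot xi xi by rewrite divfK.
pose d : V := zeta + (- c) *: xi.
have dd : dot d d = dot xi xi * (1 - c ^+ 2).
  rewrite /d !dotDl !dotDr !dotZl !dotZr (dotC zeta xi) cE -xz; ring.
have c1 : 0 <= 1 - c ^+ 2 by have := dot_ge0 d; rewrite dd pmulr_rge0.
have zE : zeta = c *: xi + d by rewrite /d addrCA -scalerDl subrr scale0r addr0.
have xd : dot xi d = 0 by rewrite /d dotDr dotZr cE mulNr subrr.
(* If c^2 = 1 then d = 0 gives no second axis, but zeta is xi or -xi and parity of the cosine
   settles the case. *)
have [cc|cn] := eqVneq (1 - c ^+ 2) 0.
  have {}zE : zeta = c *: xi by rewrite zE (enorm0 d) ?addr0// dd cc mulr0.
  have : c ^+ 2 = 1 by lra.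
  move=> /eqP; rewrite sqrf_eq1 => /orP[/eqP c1'|/eqP c1'].
    by rewrite zE c1' scale1r.
  by rewrite zE c1' scaleN1r trT_cosN.
pose s : R := Num.sqrt (1 - c ^+ 2).
have s2 : s ^+ 2 = 1 - c ^+ 2 by rewrite sqr_sqrtr.
have s0 : s != 0 by rewrite -sqrf_eq0 s2.
have c11 : -1 <= c <= 1.
  by rewrite -ler_norml -(@ler_pXn2r _ 2)// ?nnegrE// real_normK ?num_real// expr1n; lra.
have -> : zeta = cos (acos c) *: xi + sin (acos c) *: (s^-1 *: d).
  by rewrite acosK ?in_itv// sin_acos// -/s scalerA mulfV// scale1r.
rewrite trT_cos_circle//; first by rewrite dotZr xd mulr0.
rewrite dotZl dotZr dd -s2; by field.
Qed.

End radial_transform.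

(** * Passage between dimensions m and m + 2 *)

Section dimension_shift.
Context {R : realType} {m : nat}.
Notation T := (measurableTypeR R).

(** The zero goes in front, where [tuple_cons] puts the variable to be integrated out, so the phase
    does not depend on that variable. *)
Definition pad1 p (eta : 'rV[R]_p) : 'rV[R]_p.+1 :=
  \row_i oapp (eta 0) 0 (unlift ord0 i).

Lemma dot_pad1 p t (x : p.-tuple T) (eta : 'rV[R]_p) :
  dot (row_of_tuple (tuple_cons (t, x))) (pad1 eta) = dot (row_of_tuple x) eta.
Proof.
rewrite /dot big_ord_recl !mxE unlift_none/= mulr0 add0r; apply: eq_bigr => i _.
by rewrite !mxE liftK/= tnth_tuple_consS.
Qed.

Lemma dot_pad1_pad1 p (eta xi : 'rV[R]_p) : dot (pad1 eta) (pad1 xi) = dot eta xi.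
Proof.
rewrite /dot big_ord_recl !mxE unlift_none/= mulr0 add0r; apply: eq_bigr => i _.
by rewrite !mxE liftK.
Qed.

Lemma dot_tuple_cons p t (x : p.-tuple T) :
  dot (row_of_tuple (tuple_cons (t, x))) (row_of_tuple (tuple_cons (t, x))) =
  t ^+ 2 + dot (row_of_tuple x) (row_of_tuple x).
Proof.
rewrite /dot big_ord_recl !mxE; congr (_ + _).
by apply: eq_bigr => i _; rewrite !mxE tnth_tuple_consS.
Qed.

(** For fixed x the constant w x is absorbed into psi and chi, which keeps psi' = r chi, and the
    planar integral is taken with a = x.x. *)
Lemma planar_reduction (psi chi : R -> R) (w : m.-tuple T -> R) (f : m.+2.-tuple T -> R) :
  reven psi -> reven chi -> (forall r : R, is_derive r 1 psi (r * chi r)) -> wtdom f ->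
  (forall s t x, f (tuple_cons (s, tuple_cons (t, x))) =
    w x * chi (enorm (row_of_tuple (tuple_cons (s, tuple_cons (t, x)))))) ->
  \int[lebesgue_tuple m.+2]_x f x =
  \int[lebesgue_tuple m]_x (w x * (- (2 * pi) * psi (enorm (row_of_tuple x)))).
Proof.
move=> [sp ep] [sc ec] dp /wtdom_cons[/wtdom_cons[_ e2] e1] fE; rewrite e1 e2.
apply: eq_Rintegral => x _.
have ewp : reven (fun r => w x * psi r).
  by split=> [|r]; [exact: rschwartzZ|rewrite ep].
have ewc : reven (fun r => w x * chi r).
  by split=> [|r]; [exact: rschwartzZ|rewrite ec].
have dwp (r : R) : is_derive r 1 (fun r => w x * psi r) (r * (w x * chi r)).
  by apply: (is_derive_eq (is_deriveZ (w x) (dp r))); rewrite /GRing.scale/= mulrCA.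
have := planar_radial_integral ewp ewc dwp (dot_ge0 (row_of_tuple x)).
rewrite -/(enorm _) => e; transitivity (-2 * pi * (w x * psi (enorm (row_of_tuple x)))).
  rewrite -[RHS]e; apply: eq_Rintegral => t _; apply: eq_Rintegral => s _.
  rewrite fE /enorm !dot_tuple_cons; congr (_ * chi (Num.sqrt _)); ring.
ring.
Qed.

Lemma trT_dimension_shift (psi chi : R -> R) (eta : 'rV[R]_m) :
  reven psi -> reven chi -> (forall r : R, is_derive r 1 psi (r * chi r)) ->
  trT cos (fun x => m%:R * psi (enorm x) + dot x x * chi (enorm x)) eta =
  2 * pi * dot eta eta * trT cos (fun x => psi (enorm x)) (pad1 (pad1 eta)).
Proof.
move=> ep ec dp.
have sp k := @rschwartz_radial R k _ ep; have sc k := @rschwartz_radial R k _ ec.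
have pi0 : 2 * pi != 0 :> R by rewrite mulf_neq0 ?gt_eqF ?pi_gt0.
have deriv_cos (s : R) : is_derive s 1 cos (- sin s) by exact: is_derive_cos.
have deriv_sin (s : R) : is_derive s 1 sin (cos s) by exact: is_derive_sin.
(* Integration by parts of d_j (psi^O) = x_j chi^O in R^(m+2), then planar reduction with weight x_j
   sin(2 pi x.eta). Each of the two operations contributes a factor -2 pi, and these cancel. *)
have lift_eta (j : 'I_m) : eta 0 j * trT cos (fun x => psi (enorm x)) (pad1 (pad1 eta)) =
    trT sin (fun x => x 0 j * psi (enorm x)) eta.
  pose v := pad1 (pad1 (delta_mx 0 j : 'rV[R]_m)).
  have := trT_derive v (pad1 (pad1 eta)) wave_sin wave_cos deriv_sin (sp m.+2).
  rewrite !dot_pad1_pad1 dot_delta (derive_radialE v ep dp).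
  have svc : rschwartz 'rV[R]_m.+2 (fun x => dot x v * chi (enorm x)).
    by apply: rschwartzM => //; exact: linform_dot.
  rewrite {1}/trT (planar_reduction (psi := psi) (chi := chi)
    (w := fun x => tnth x j * sin (2 * pi * dot (row_of_tuple x) eta)))//; first last.
  - move=> s t x; rewrite !dot_pad1 /v dotC dot_delta mxE; ring.
  - exact: (trT_wtdom _ wave_sin svc).
  have -> : \int[lebesgue_tuple m]_x (tnth x j * sin (2 * pi * dot (row_of_tuple x) eta) *
      (- (2 * pi) * psi (enorm (row_of_tuple x)))) =
      - (2 * pi) * trT sin (fun x => x 0 j * psi (enorm x)) eta.
    rewrite -trTZ; [|exact: wave_sin|by apply: rschwartzM => //; exact: linform_coord].
    by apply: eq_Rintegral => x _; rewrite mxE; ring.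
  rewrite -(mulNr (2 * pi)) -[X in _ = X -> _]mulrA => /mulfI E; apply/esym/E.
  by rewrite oppr_eq0.
(* A second integration by parts, now in R^m, turns the sine transform of x_j psi^O into the cosine
   transform of d_j (x_j psi^O). *)
have step (j : 'I_m) : trT cos (fun x => psi (enorm x) + (x 0 j) ^+ 2 * chi (enorm x)) eta =
    2 * pi * (eta 0 j * eta 0 j) * trT cos (fun x => psi (enorm x)) (pad1 (pad1 eta)).
  rewrite -!mulrA lift_eta mulrA.
  pose v : 'rV[R]_m := delta_mx 0 j.
  have sv : rschwartz 'rV[R]_m (fun x => dot x v * psi (enorm x)).
    by apply: rschwartzM => //; exact: linform_dot.
  have xv (x : 'rV[R]_m) : dot x v = x 0 j by rewrite dotC dot_delta.
  have es : trT sin (fun x => dot x v * psi (enorm x)) eta =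
      trT sin (fun x => x 0 j * psi (enorm x)) eta.
    by apply: eq_trT => x; rewrite xv.
  have := trT_derive v eta wave_cos wave_sinN deriv_cos sv.
  rewrite (derive_dotM v v (sp m)) trT_sinN trTZ//; last exact: wave_sin.
  rewrite es [dot v eta]dot_delta mulN1r mulrN mulNr opprK [X in _ -> _ = X]mulrA => <-.
  apply: eq_trT => x; rewrite (derive_radial _ _ ep dp) !xv.
  by rewrite mxE !eqxx mul1r mulrA expr2.
have sq (j : 'I_m) : rschwartz 'rV[R]_m (fun x => psi (enorm x) + (x 0 j) ^+ 2 * chi (enorm x)).
  apply: rschwartzD => //; under eq_fun do rewrite expr2 -mulrA.
  by do 2 (apply: rschwartzM; first exact: linform_coord).
transitivity (\sum_(j < m) trT cos (fun x => psi (enorm x) + (x 0 j) ^+ 2 * chi (enorm x)) eta).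
  transitivity (trT cos (fun x => \sum_(j < m) (psi (enorm x) + (x 0 j) ^+ 2 * chi (enorm x))) eta).
    apply: eq_trT => x; rewrite big_split/= sumr_const card_ord mulr_natl.
    by congr (_ + _); rewrite /dot mulr_suml; apply: eq_bigr => i _; rewrite expr2.
  elim: (index_enum _) => [|j s IH].
    rewrite big_nil -[RHS](mul0r (trT cos (fun x => psi (enorm x)) eta)) -trTZ//.
      by apply: eq_trT => x; rewrite big_nil mul0r.
    exact: wave_cos.
  rewrite big_cons -IH -trTD//; first by apply: eq_trT => x; rewrite big_cons.
    exact: wave_cos.
  exact: rschwartz_sum.
under eq_bigr do rewrite step.
by rewrite -mulr_suml -mulr_sumr.
Qed.

End dimension_shift.

(** * The sphere *)

Section sphere.
Context {R : realType}.
Notation T := (measurableTypeR R).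
Notation mu := (@lebesgue_measure R).

Lemma measurable_cube m (a : R) :
  measurable [set x : m.-tuple T | forall i, 0 < tnth x i <= a].
Proof.
rewrite (_ : [set _ | _] = \bigcap_(i in [set: 'I_m])
    ((fun x : m.-tuple T => tnth x i) @^-1` `]0, a]%classic)); last first.
  by apply/seteqP; split=> x /= => [h i _|h i]; have := h i; rewrite /= in_itv/= //; apply.
apply: fin_bigcap_measurable => // i _.
by rewrite -[X in measurable X]setTI; apply: measurable_tnth.
Qed.

Lemma lebesgue_tuple_cube m (a : R) : 0 < a ->
  lebesgue_tuple m [set x : m.-tuple T | forall i, 0 < tnth x i <= a] = (a ^+ m)%:E.
Proof.
move=> a0; elim: m => [|m IH].
  rewrite /= diracE mem_set//= => -[] //.
rewrite -[LHS]/((mu \x lebesgue_tuple m)%E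
  (@tuple_cons R m @^-1` [set x | forall i, 0 < tnth x i <= a])).
rewrite (_ : _ @^-1` _ = `]0, a]%classic `*`
    [set x : m.-tuple T | forall i, 0 < tnth x i <= a]); last first.
  apply/seteqP; split=> -[t x] /=; rewrite in_itv/=.
    move=> h; split=> [|i]; first by have := h ord0; rewrite tnth_tuple_cons0.
    by have := h (lift ord0 i); rewrite tnth_tuple_consS.
  move=> [ht hx] i; case: (unliftP ord0 i) => [j ->|->].
    by rewrite tnth_tuple_consS.
  by rewrite tnth_tuple_cons0.
rewrite product_measure1E//; last exact: measurable_cube.
rewrite [X in (_ * X)%E]IH [X in (X * _)%E]lebesgue_measure_itv/= lte_fin a0.
by rewrite oppr0 adde0 -EFinM exprS.
Qed.

(** On the unit ball every 1 + x_i^2 is at most 2, so the indicator function is below 2^m times the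
    integrable weight. *)
Lemma punctured_ball_lty m : (lebesgue_tuple m (@punctured_ball R m) < +oo)%E.
Proof.
have mB := @measurable_punctured_ball R m.
rewrite -[X in (X < _)%E]mul1e -integral_cst//.
apply: (@le_lt_trans _ _ (\int[lebesgue_tuple m]_(x in @punctured_ball R m)
    (2 ^+ m * wt x)%:E)%E).
  apply: ge0_le_integral => //.
  - by apply/measurable_EFinP/measurable_funTS; apply: measurable_funM => //; exact: measurable_wt.
  - move=> x /= /andP[_ x1]; rewrite lee_fin /wt prodfV.
    rewrite ler_pdivlMr; last by apply: prodr_gt0 => i _; exact: oneDsqr_gt0.
    rewrite mul1r (_ : 2 ^+ m = \prod_(i < m) 2); last by rewrite prodr_const card_ord.
    apply: ler_prod => i _; rewrite (ltW (oneDsqr_gt0 _))/= /oneDsqr/=.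
    have : `|tnth x i| <= 1.
      by apply: le_trans x1; have := coord_le_enorm (row_of_tuple x) i; rewrite mxE.
    rewrite -[tnth x i ^+ 2]real_normK ?num_real//; have := normr_ge0 (tnth x i); nra.
apply: (@le_lt_trans _ _ (\int[lebesgue_tuple m]_x (2 ^+ m * wt x)%:E)%E).
  apply: ge0_subset_integral => //.
  - by apply/measurable_EFinP; apply: measurable_funM => //; exact: measurable_wt.
  - by move=> x _; rewrite lee_fin mulr_ge0 ?exprn_ge0// ltW// wt_gt0.
under eq_integral do rewrite EFinM.
rewrite ge0_integralZl_EFin//.
- by rewrite lte_mul_pinfty ?lee_fin ?exprn_ge0//; exact: integral_wt.
- by move=> x _; rewrite lee_fin ltW// wt_gt0.
- exact: measurable_wtE.
Qed.

(** The ball contains the cube ]0, 1/m]^m: each x_i^2 is at most 1/m there, and the m squares add up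
    to at most 1. *)
Lemma punctured_ball_gt0 m : (0 < m)%N -> (0 < lebesgue_tuple m (@punctured_ball R m))%E.
Proof.
move=> m0; have a0 : 0 < (m%:R : R)^-1 by rewrite invr_gt0 ltr0n.
apply: (@lt_le_trans _ _ (lebesgue_tuple m
    [set x : m.-tuple T | forall i, 0 < tnth x i <= m%:R^-1])).
  by rewrite lebesgue_tuple_cube// lte_fin exprn_gt0.
apply: le_measure; rewrite ?inE; [exact: measurable_cube|exact: measurable_punctured_ball|].
move=> x /= hx; have d0 : 0 < dot (row_of_tuple x) (row_of_tuple x).
  rewrite /dot (bigD1 (Ordinal m0))//= ltr_pwDl//.
    by rewrite !mxE; have /andP[h _] := hx (Ordinal m0); rewrite mulr_gt0.
  by apply: sumr_ge0 => i _; rewrite -expr2 sqr_ge0.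
rewrite /punctured_ball/= /enorm sqrtr_gt0 d0/= -sqrtr1 ler_wsqrtr//.
apply: (@le_trans _ _ (\sum_(i < m) m%:R^-1)); last first.
  by rewrite sumr_const card_ord -[leLHS]mulr_natr mulVf// pnatr_eq0 -lt0n.
apply: ler_sum => i _; rewrite !mxE; have /andP[h1 h2] := hx i.
have m1 : (m%:R : R)^-1 <= 1 by rewrite invf_le1 ?ltr0n// ler1n.
nra.
Qed.

Lemma sphere_measureTE m : sphere_measure m [set: m.-tuple T] =
  (m%:R%:E * lebesgue_tuple m (@punctured_ball R m))%E.
Proof.
by rewrite /sphere_measure/= /mscale/= /cone_measure /pushforward preimage_setT /mrestr setTI.
Qed.

Lemma sphere_area_gt0 m : (0 < m)%N -> 0 < @sphere_area R m.
Proof.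
move=> m0; rewrite /sphere_area sphere_measureTE fine_gt0// mule_gt0 ?lte_fin ?ltr0n//=.
  by rewrite lte_mul_pinfty ?lee_fin ?ler0n//; exact: punctured_ball_lty.
exact: punctured_ball_gt0.
Qed.

(** The surface measure is defined on all tuples, but as an image under [direction] it gives no mass
    to non-unit vectors; on unit vectors the integrand is constant. *)
Lemma Rintegral_sphere_radial m (g : 'rV[R]_m -> R) (e : 'rV[R]_m) (r : R) :
  continuous g -> (forall x y, enorm x = enorm y -> g x = g y) -> enorm e = 1 ->
  \int[sphere_measure m]_th g (r *: row_of_tuple th) = @sphere_area R m * g (r *: e).
Proof.
move=> cg gr e1.
transitivity (\int[sphere_measure m]_(th in setT) g (r *: e)); last first.
  by rewrite Rintegral_cst// mulrC.
rewrite /Rintegral; congr fine; apply: ae_eq_integral => //.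
- apply/measurable_EFinP; apply: (@measurable_row R m (fun x => g (r *: x))).
  exact: (continuousT_comp (@scaler_continuous _ _ r) cg).
- pose S : set (m.-tuple T) := (fun x => enorm (row_of_tuple x) : T) @^-1` [set 1].
  exists (~` S); split.
  + apply: measurableC; rewrite -[X in measurable X]setTI.
    by apply: measurable_enorm => //; exact: measurable_set1.
  + rewrite /sphere_measure/= /mscale/= /cone_measure /pushforward /mrestr.
    rewrite (_ : _ `&` _ = set0) ?measure0 ?mule0//.
    apply/seteqP; split=> // x [] /= h /andP[x0 x1]; apply: h.
    rewrite /S/= (_ : row_of_tuple _ = (enorm (row_of_tuple x))^-1 *: row_of_tuple x).
      by rewrite enormZ ger0_norm ?invr_ge0 ?ltW// mulVf// gt_eqF.
    by apply/rowP => i; rewrite !mxE tnth_mktuple mulrC.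
  + move=> x /= h Sx; apply: h => _; congr EFin; apply: gr.
    by rewrite !enormZ e1 Sx.
Qed.

Lemma spherical_mean_radial m (phi : 'rV[R]_m -> R[i]) (e : 'rV[R]_m) (r : R) :
  (0 < m)%N -> continuous (fun x => complex.Re (phi x)) ->
  continuous (fun x => complex.Im (phi x)) ->
  (forall x y, enorm x = enorm y -> phi x = phi y) -> enorm e = 1 ->
  spherical_mean phi r = phi (r *: e).
Proof.
move=> m0 c1 c2 hphi e1; have a0 : @sphere_area R m != 0 by rewrite gt_eqF ?sphere_area_gt0.
rewrite /spherical_mean /cintegral.
rewrite (Rintegral_sphere_radial r c1 _ e1); last by move=> x y /hphi ->.
rewrite (Rintegral_sphere_radial r c2 _ e1); last by move=> x y /hphi ->.
case: (phi (r *: e)) => a b /=; apply/eqP; rewrite eq_complex/=.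
by rewrite !mul0r subr0 addr0 !mulKf// !eqxx.
Qed.

End sphere.

(** * Complex-valued functions and the final computation *)

Local Open Scope complex_scope.

Section complex_radial.
Context {R : realType}.
Notation T := (measurableTypeR R).
Implicit Types psi : R -> R[i].

Lemma even_schwartzP psi : even_schwartz psi <->
  reven (fun r => complex.Re (psi r)) /\ reven (fun r => complex.Im (psi r)).
Proof.
split=> [[/schwartzP[s1 s2] e]|[[s1 e1] [s2 e2]]].
  by split; split=> // r; rewrite e.
split; first exact/schwartzP.
by move=> r; apply/eqP; rewrite eq_complex e1 e2 !eqxx.
Qed.

(** For f = a + i b the transform has real part cos-transform of a plus sin-transform of b, and
    imaginary part cos-transform of b minus sin-transform of a; the sine terms vanish by parity. *)
Lemma fourier_radial_ext m psi xi : even_schwartz psi ->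
  fourier (radial_ext m psi) xi =
  trT cos (fun x => complex.Re (psi (enorm x))) xi +i*
  trT cos (fun x => complex.Im (psi (enorm x))) xi.
Proof.
move=> /even_schwartzP[ea eb].
have [sa sb] := (@rschwartz_radial R m _ ea, @rschwartz_radial R m _ eb).
have enormN (x : 'rV[R]_m) : enorm (- x) = enorm x by rewrite -scaleN1r enormZ normrN1 mul1r.
have za : trT sin (fun x => complex.Re (psi (enorm x))) xi = 0.
  by apply: trT_sin_even => // x; rewrite enormN.
have zb : trT sin (fun x => complex.Im (psi (enorm x))) xi = 0.
  by apply: trT_sin_even => // x; rewrite enormN.
rewrite /fourier /cintegral; congr (_ +i* _).
  rewrite -[RHS]addr0 -zb -RintegralD//; last 2 first.
  - exact: (trT_integrable xi wave_cos sa).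
  - exact: (trT_integrable xi wave_sin sb).
  apply: eq_Rintegral => x _; rewrite /radial_ext /cis.
  by case: (psi _) => a b /=; rewrite cosN sinN mulrN opprK.
rewrite -[RHS]subr0 -za -RintegralB//; last 2 first.
- exact: (trT_integrable xi wave_cos sb).
- exact: (trT_integrable xi wave_sin sa).
apply: eq_Rintegral => x _; rewrite /radial_ext /cis.
by case: (psi _) => a b /=; rewrite cosN sinN mulrN addrC.
Qed.

Lemma rschwartz_trT_cos m (g : 'rV[R]_m -> R) : rschwartz 'rV[R]_m g ->
  rschwartz 'rV[R]_m (trT cos g).
Proof.
move=> sg; have := rschwartz_trT sg rschwartz0.
rewrite (_ : (fun _ => _) = trT cos g)//; apply/funext => xi.
by rewrite (trT_sin_even _ rschwartz0)// addr0.
Qed.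

Lemma fourier_radial_ext_enorm m psi (xi zeta : 'rV[R]_m) : even_schwartz psi ->
  enorm xi = enorm zeta ->
  fourier (radial_ext m psi) xi = fourier (radial_ext m psi) zeta.
Proof.
move=> epsi xz; rewrite !fourier_radial_ext//; have /even_schwartzP[ea eb] := epsi.
by rewrite (trT_cos_radial ea xz) (trT_cos_radial eb xz).
Qed.

Lemma schwartz_fourier_radial m psi : even_schwartz psi ->
  schwartz 'rV[R]_m (fourier (radial_ext m psi)).
Proof.
move=> epsi; have /even_schwartzP[ea eb] := epsi.
rewrite (_ : fourier _ = fun xi => trT cos (fun x => complex.Re (psi (enorm x))) xi +i*
  trT cos (fun x => complex.Im (psi (enorm x))) xi); last first.
  by apply/funext => xi; rewrite fourier_radial_ext.
apply/schwartzP; split; apply: rschwartz_trT_cos.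
  exact: (rschwartz_radial ea).
exact: (rschwartz_radial eb).
Qed.

Lemma radial_fun_fourier m psi : even_schwartz psi ->
  radial_fun (fourier (radial_ext m psi)).
Proof.
move=> epsi A oA x; apply: fourier_radial_ext_enorm => //.
congr (Num.sqrt _).
have dotE (y z : 'rV[R]_m) : dot y z = (y *m z^T) 0 0.
  by rewrite mxE; apply: eq_bigr => i _; rewrite mxE.
by rewrite !dotE trmx_mul mulmxA -[x *m A *m _]mulmxA oA mulmx1.
Qed.

Lemma spherical_mean_fourier m psi (e : 'rV[R]_m) r : (0 < m)%N -> even_schwartz psi ->
  enorm e = 1 ->
  spherical_mean (fourier (radial_ext m psi)) r = fourier (radial_ext m psi) (r *: e).
Proof.
move=> m0 epsi e1; have /schwartzP[/rschwartzW[c1 _ _] /rschwartzW[c2 _ _]] :=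
  @schwartz_fourier_radial m _ epsi.
by apply: spherical_mean_radial => // x y; exact: fourier_radial_ext_enorm.
Qed.

Lemma rschwartzXn (f : R -> R) k : rschwartz R f -> rschwartz R (fun r => r ^+ k * f r).
Proof.
move=> sf; elim: k => [|k IH]; first by under eq_fun do rewrite expr0 mul1r.
by under eq_fun do rewrite exprS -mulrA; apply: rschwartzM => //; exact: linform_id.
Qed.

(* [n psi + r psi'], so that [(r^n psi)' = r^(n-1) euler_op n psi]. *)
Definition euler_op n psi (r : R) : R[i] :=
  n%:R%:C * psi r + r%:C * cderive (1 : R) psi r.

Lemma euler_op_coord n psi (chi1 chi2 : R -> R) r :
  (forall r : R, is_derive r 1 (fun r => complex.Re (psi r)) (r * chi1 r)) ->
  (forall r : R, is_derive r 1 (fun r => complex.Im (psi r)) (r * chi2 r)) ->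
  euler_op n psi r = (n%:R * complex.Re (psi r) + r ^+ 2 * chi1 r) +i*
    (n%:R * complex.Im (psi r) + r ^+ 2 * chi2 r).
Proof.
move=> d1 d2; rewrite /euler_op /cderive; have [_ ->] := d1 r; have [_ ->] := d2 r.
by case: (psi r) => a b /=; apply/eqP; rewrite eq_complex/= !mul0r !subr0 !addr0 !expr2 !mulrA !eqxx.
Qed.

Lemma euler_op_even_schwartz n psi : even_schwartz psi -> even_schwartz (euler_op n psi).
Proof.
move=> /even_schwartzP[ea eb]; have [chi1 ec1 d1] := reven_derive ea.
have [chi2 ec2 d2] := reven_derive eb.
rewrite (_ : euler_op n psi = fun r => (n%:R * complex.Re (psi r) + r ^+ 2 * chi1 r) +i*
    (n%:R * complex.Im (psi r) + r ^+ 2 * chi2 r)); last first.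
  by apply/funext => r; exact: euler_op_coord.
have ev (a chi : R -> R) : reven a -> reven chi -> reven (fun r => n%:R * a r + r ^+ 2 * chi r).
  move=> [sa ea'] [sc ec]; split=> [|r]; last by rewrite ea' ec sqrrN.
  by apply: rschwartzD; [exact: rschwartzZ|exact: rschwartzXn].
by apply/even_schwartzP; split; exact: ev.
Qed.

Lemma derive_weighted n psi : (0 < n)%N -> even_schwartz psi ->
  (fun r : R => cderive (1 : R) (fun s => weighted n.+2 psi s / s%:C) r) =
  weighted n (euler_op n psi).
Proof.
(* The dimension is now [n.+1]: [weighted n.+3] carries the power n + 2, its quotient by s the power
   n + 1, and the derivative the power n. *)
case: n => // n _ epsi; have /even_schwartzP[ea eb] := epsi.
have [chi1 ec1 d1] := reven_derive ea; have [chi2 ec2 d2] := reven_derive eb.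
have fE : (fun s : R => weighted n.+3 psi s / s%:C) =
    fun s => (s ^+ n.+1 * complex.Re (psi s)) +i* (s ^+ n.+1 * complex.Im (psi s)).
  apply/funext => s; rewrite /weighted/=.
  have -> : psi s * (s ^+ n.+2)%:C / s%:C = psi s * (s ^+ n.+1)%:C.
    have [->|s0] := eqVneq s 0; first by rewrite !expr0n/= !mulr0 mul0r.
    rewrite exprSr rmorphM/= mulrA mulfK//.
    by rewrite -[0]/(0%:C) (inj_eq (fmorph_inj _)).
  case: (psi s) => a b; apply/eqP; rewrite eq_complex/= !mulr0 subr0 add0r.
  by rewrite ![_ * s ^+ _]mulrC !eqxx.
have dw (a chi : R -> R) (r : R) : (forall r : R, is_derive r 1 a (r * chi r)) ->
    'D_1 (fun s : R => s ^+ n.+1 * a s) r = r ^+ n * (n.+1%:R * a r + r ^+ 2 * chi r).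
  move=> da; have dX : is_derive r 1 (fun s : R => s ^+ n.+1) (n.+1%:R * r ^+ n).
    by apply: DeriveDef; [exact: exprn_derivable|rewrite exp_derive [LHS]mulr1].
  have [_ ->] := is_deriveM dX (da r); rewrite /GRing.scale/= exprS; ring.
apply/funext => r; rewrite fE /cderive /= (dw _ chi1)// (dw _ chi2)//.
rewrite /weighted (euler_op_coord _ _ d1 d2)/=; apply/eqP; rewrite eq_complex/=.
by rewrite !mulr0 subr0 add0r ![_ * r ^+ n]mulrC !eqxx.
Qed.

Lemma fourier_euler_op n psi (eta : 'rV[R]_n) : even_schwartz psi ->
  fourier (radial_ext n (euler_op n psi)) eta =
  (2 * pi * dot eta eta)%:C * fourier (radial_ext n.+2 psi) (pad1 (pad1 eta)).
Proof.
move=> epsi; rewrite !fourier_radial_ext//; last exact: euler_op_even_schwartz.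
have /even_schwartzP[ea eb] := epsi.
have [chi1 ec1 d1] := reven_derive ea; have [chi2 ec2 d2] := reven_derive eb.
have e1 := trT_dimension_shift eta ea ec1 d1; have e2 := trT_dimension_shift eta eb ec2 d2.
rewrite (eq_trT _ _ (h := fun x => n%:R * complex.Re (psi (enorm x)) + dot x x * chi1 (enorm x))).
  rewrite (eq_trT _ _ (g := fun x => complex.Im _)
    (h := fun x => n%:R * complex.Im (psi (enorm x)) + dot x x * chi2 (enorm x))).
    by rewrite e1 e2; apply/eqP; rewrite eq_complex/= !mul0r subr0 addr0 !eqxx.
  by move=> x; rewrite (euler_op_coord _ _ d1 d2)/= sqr_enorm.
by move=> x; rewrite (euler_op_coord _ _ d1 d2)/= sqr_enorm.
Qed.

Lemma tempered_scale (V : normedModType R) (u : (V -> R[i]) -> R[i]) (c : R[i]) f :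
  tempered V u -> schwartz V f -> u (fun x => c * f x) = c * u f.
Proof.
move=> [lu _] sf; have s0 : schwartz V (fun=> 0).
  by apply/schwartzP; split; exact: rschwartz0.
have u0 : u (fun=> 0) = 0.
  have := lu 1 _ _ s0 s0; rewrite (_ : (fun _ => _) = fun=> 0).
    by rewrite mul1r -{1}[u _]addr0 => /addrI.
  by apply/funext => x; rewrite mulr0 addr0.
have := lu c _ _ sf s0; rewrite u0 addr0 => <-.
by congr u; apply/funext => x; rewrite addr0.
Qed.

Lemma schwartz_radial_profile m psi (e : 'rV[R]_m) k : even_schwartz psi -> `|e| = 1 ->
  schwartz R (fun r : R => (r ^+ k)%:C * fourier (radial_ext m psi) (r *: e)).
Proof.
move=> epsi e1; have /schwartzP[s1 s2] := @schwartz_fourier_radial m _ epsi.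
apply/schwartzP; split.
  have := rschwartzXn k (rschwartz_line e1 s1).
  rewrite (_ : (fun _ => _) = fun r : R => complex.Re ((r ^+ k)%:C *
    fourier (radial_ext m psi) (r *: e)))//.
  by apply/funext => r; case: (fourier _ _) => a b /=; rewrite mul0r subr0.
have := rschwartzXn k (rschwartz_line e1 s2).
rewrite (_ : (fun _ => _) = fun r : R => complex.Im ((r ^+ k)%:C *
  fourier (radial_ext m psi) (r *: e)))//.
by apply/funext => r; case: (fourier _ _) => a b /=; rewrite mul0r addr0.
Qed.

Lemma pad1Z p (r : R) (eta : 'rV[R]_p) : pad1 (r *: eta) = r *: pad1 eta.
Proof.
apply/rowP => i; rewrite !mxE; case: (unlift ord0 i) => [j|] /=; first by rewrite mxE.
by rewrite mulr0.
Qed.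

End complex_radial.

(** On r^(n+1) psi both sides become multiples of [v0 Q], where Q(r) is r^(n+1) times the
    (n+2)-dimensional transform of psi^O at r e2. On the left the power arises as r^(n-1), from the
    definition of [vn], times |r e|^2, from [fourier_euler_op]. *)
Theorem theorem4p1 (R : realType) (n : nat) (n_gt0 : (0 < n)%N)
  (v0 : (R -> R[i]) -> R[i])
  (v0_tempered : tempered R v0) (v0_even : even_distr v0)
  (vn : ('rV[R]_n -> R[i]) -> R[i])
  (vn_tempered : tempered 'rV[R]_n vn) (vn_radial : radial_distr vn)
  (vnE : forall phi : 'rV[R]_n -> R[i],
     schwartz 'rV[R]_n phi -> radial_fun phi ->
     vn phi = v0 (fun r =>
       (2^-1 * sphere_area n * r ^+ n.-1)%:C * spherical_mean phi r))
  (vn2 : ('rV[R]_n.+2 -> R[i]) -> R[i])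
  (vn2_tempered : tempered 'rV[R]_n.+2 vn2) (vn2_radial : radial_distr vn2)
  (vn2E : forall phi : 'rV[R]_n.+2 -> R[i],
     schwartz 'rV[R]_n.+2 phi -> radial_fun phi ->
     vn2 phi = v0 (fun r =>
       (2^-1 * sphere_area n.+2 * r ^+ n.+1)%:C * spherical_mean phi r)) :
  let un := fourier_distr vn in
  let un2 := fourier_distr vn2 in
  forall f : R -> R[i], Rspace n.+2 f ->
    (- (2 * pi)^-1)%:C * inv_r_ddr (diamond un) f = diamond un2 f.
Proof.
move=> un un2 _ [psi epsi <-].
(* The transforms are radial, so their spherical means are read off along one unit vector; padding
   [e] makes the rays in the two dimensions correspond. *)
pose e : 'rV[R]_n := delta_mx 0 (Ordinal n_gt0); pose e2 := pad1 (pad1 e).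
have ee : dot e e = 1 by rewrite dot_delta mxE !eqxx.
have e1 : enorm e = 1 by rewrite /enorm ee sqrtr1.
have e21 : enorm e2 = 1 by rewrite /enorm !dot_pad1_pad1 ee sqrtr1.
(* This is the sup norm, in which the decay of Schwartz functions is measured. *)
have ne2 : `|e2| = 1.
  apply/eqP; rewrite eq_le -{1}e21 norm_le_enorm/=.
  have := coord_le_norm e2 (lift ord0 (lift ord0 (Ordinal n_gt0))).
  by rewrite !mxE liftK/= mxE liftK/= mxE !eqxx normr1.
pose Q (r : R) := (r ^+ n.+1)%:C * fourier (radial_ext n.+2 psi) (r *: e2).
have sQ : schwartz R Q by exact: schwartz_radial_profile.
have eth := euler_op_even_schwartz n epsi.
have an : sphere_area n != 0 :> R by rewrite gt_eqF ?sphere_area_gt0.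
have an2 : sphere_area n.+2 != 0 :> R by rewrite gt_eqF ?sphere_area_gt0.
have pi0 : pi != 0 :> R by rewrite gt_eqF ?pi_gt0.
rewrite /inv_r_ddr derive_weighted// !diamondE// /un /un2 /fourier_distr.
rewrite vnE; [|exact: schwartz_fourier_radial|exact: radial_fun_fourier].
rewrite vn2E; [|exact: schwartz_fourier_radial|exact: radial_fun_fourier].
(* The constant is omega_(n-1) / 2 from [vnE] times the 2 pi of the pointwise identity. *)
rewrite (_ : (fun r => _ * spherical_mean (fourier (radial_ext n _)) r) =
    (fun r => (sphere_area n * pi)%:C * Q r)); last first.
  apply/funext => r; rewrite (spherical_mean_fourier r n_gt0 eth e1).
  rewrite (fourier_euler_op (r *: e) epsi) (pad1Z r e) (pad1Z r (pad1 e)).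
  rewrite dotZl dotZr ee mulr1 /Q.
  have rn : r ^+ n.+1 = r ^+ n.-1 * r ^+ 2 by rewrite -exprD addn2 prednK.
  by rewrite mulrA [RHS]mulrA -!rmorphM/= rn; congr (_%:C * _); field.
rewrite (_ : (fun r => _ * spherical_mean (fourier (radial_ext n.+2 _)) r) =
    (fun r => (2^-1 * sphere_area n.+2)%:C * Q r)); last first.
  apply/funext => r; rewrite (spherical_mean_fourier r (ltn0Sn n.+1) epsi e21).
  by rewrite /Q mulrA -rmorphM.
(* Both coefficients of [v0 Q] equal 1: (2 pi)^-1 (2 / omega_(n-1)) (omega_(n-1) pi) on the left, (2
   / omega_(n+1)) (omega_(n+1) / 2) on the right. *)
rewrite !tempered_scale// mulrN -mulNr -rmorphN opprK !mulrA -!rmorphM/=.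
congr (_%:C * _); move: pi0 an an2.
move: (pi : R) (sphere_area n : R) (sphere_area n.+2 : R) => p a b p0 a0 b0.
by field; rewrite p0 a0 b0.
Qed.
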